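(* Let $(Y(n))_{n\in\mathbb N}$ be complex $n\times n$ random matrices such that, for each $n$, $\{\mathrm{Re}\,Y_{i,j}(n),\mathrm{Im}\,Y_{i,j}(n):i,j\in[n]\}$ are independent Gaussian random variables with zero mean and variances $\mathbb E((\mathrm{Re}\,Y_{i,j}(n))^2)=\mathbb E((\mathrm{Im}\,Y_{i,j}(n))^2)=v_{a,b}/2n$ for $(i,j)\in N_a\times N_b$, $a,b\in\{1,2\}$, where $(v_{a,b})$ is symmetric and $v_{1,2}=1$. Let $B(n)=T_{1,2}(n)$ and suppose $d_1>0$. Then $$\lim_{n\to\infty}\tau_1(n)\big((B(n)B^*(n))^k\big)=d_1^{\,k}N_k(d_2/d_1)$$ for every $k\in\mathbb N$, and thus the limit distribution is the $d_1$-dilation of the Marchenko-Pastur distribution $\varrho_t$ with shape parameter $t=d_2/d_1$.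
   Context: For each $n$ let $[n]=\{1,\dots,n\}$ be partitioned into disjoint nonempty intervals $N_1,N_2$ (depending on $n$), $n_q=|N_q|$, with $d_q=\lim_{n\to\infty}n_q/n\ge0$. $D_q$ is the $n\times n$ diagonal matrix with $(D_q)_{j,j}=1$ if $j\in N_q$ and all other entries $0$. $T_{1,2}(n)=D_1Y(n)D_2+D_2Y(n)D_1$. $\tau_1(n)(A)=\frac1{n_1}\mathbb E\sum_{j\in N_1}A_{j,j}$. Narayana polynomials: $N_k(t)=\sum_{j=1}^kN(k,j)t^j$ with $N(k,j)=\frac1j\binom{k-1}{j-1}\binom{k}{j-1}$. Marchenko-Pastur distribution with shape parameter $t>0$: $\varrho_t=\max\{1-t,0\}\delta_0+\frac{\sqrt{(x-a)(b-x)}}{2\pi x}1_{[a,b]}(x)\,dx$ with $a=(1-\sqrt t)^2$, $b=(1+\sqrt t)^2$ (for $t=0$ the formula is read as $\delta_0$). The $\lambda$-dilation of a probability measure with moments $m_k$ is the measure with moments $\lambda^km_k$, i.e. its image under $x\mapsto\lambda x$. ''Limit distribution'' is the probability measure whose $k$-th moment is $\lim_{n\to\infty}\tau_1(n)\big((B(n)B^*(n))^k\big)$ for all $k\in\mathbb N$. *)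

(* Defs.v *)
From HB Require Import structures.
From mathcomp Require Export all_boot all_order all_algebra.
From mathcomp Require Export all_classical all_reals all_analysis.
From mathcomp Require Export measurable_realfun.
From mathcomp.real_closed Require Export complex.
Export Order.TTheory GRing.Theory Num.Theory.
Export numFieldNormedType.Exports.

Set Implicit Arguments.
Unset Strict Implicit.
Unset Printing Implicit Defensive.

Local Open Scope classical_set_scope.
Local Open Scope ring_scope.

(* Conventions: the index set [n] = {1, ..., n} is 'I_n, and the labels
   q = 1, 2 of the two blocks are the elements 0 and 1 of 'I_2. *)

Definition is_interval_set n (A : {set 'I_n}) : Prop :=
  forall i j k : 'I_n, i \in A -> k \in A -> (i <= j <= k)%N -> j \in A.

Definition is_interval_partition n (N : 'I_2 -> {set 'I_n}) : Prop :=
  [/\ forall q, N q != finset.set0,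
      forall q, is_interval_set (N q),
      (N 0 :&: N 1)%SET = finset.set0 &
      (N 0 :|: N 1)%SET = [set: 'I_n]%SET].

Section RandomVariables.
Context (disp : measure_display) (T : measurableType disp) (R : realType).
Variable P : probability T R.

(* [normal_prob m s] is parametrized by the standard deviation, and by
   convention is uniform on [0, 1] when s = 0; the Gaussian law of variance 0
   is the Dirac mass at the mean. *)
Definition centered_gaussian_law (s2 : R) : set R -> \bar R :=
  if s2 == 0 then \d_(0 : R) else normal_prob 0 (Num.sqrt s2).

Definition is_centered_gaussian (X : T -> R) (s2 : R) : Prop :=
  measurable_fun setT X /\
  forall A : set R, measurable A -> P (X @^-1` A) = centered_gaussian_law s2 A.

Definition mutually_independent (I : finType) (X : I -> T -> R) : Prop :=
  forall (J : {set I}) (A : I -> set R), (forall i, measurable (A i)) ->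
    P (\bigcap_(i in [set` J]) (X i @^-1` A i)) =
    (\prod_(i in J) P (X i @^-1` A i))%E.

(* [fine] sends an infinite expectation to 0; it is only applied here to
   polynomials in Gaussian variables, which are integrable. *)
Definition complex_expectation (f : T -> R[i]) : R[i] :=
  Complex (fine ('E_P[fun w => complex.Re (f w)]))
          (fine ('E_P[fun w => complex.Im (f w)])).

Definition part_of_entry n (Y : T -> 'M[R[i]]_n) (x : bool * ('I_n * 'I_n)) :
    T -> R :=
  fun w => let y := Y w x.2.1 x.2.2 in
           if x.1 then complex.Im y else complex.Re y.

(* The real parts (false) and imaginary parts (true) of all entries form one
   independent family. *)
Definition is_block_gaussian n (N : 'I_2 -> {set 'I_n}) (v : 'M[R]_2)
    (Y : T -> 'M[R[i]]_n) : Prop :=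
  mutually_independent (part_of_entry Y) /\
  forall (a b : 'I_2) (i j : 'I_n), i \in N a -> j \in N b ->
    forall im : bool,
      is_centered_gaussian (part_of_entry Y (im, (i, j))) (v a b / (2 * n%:R)).

Definition partial_trace n (S : {set 'I_n}) (A : T -> 'M[R[i]]_n) : R[i] :=
  (#|S|%:R)^-1 * complex_expectation (fun w => \sum_(j in S) A w j j).

End RandomVariables.

Section Matrices.
Variable R : realType.

Definition block_proj n (S : {set 'I_n}) : 'M[R[i]]_n :=
  diag_mx (\row_(j < n) (j \in S)%:R).

Definition off_diagonal_block n (N : 'I_2 -> {set 'I_n}) (Y : 'M[R[i]]_n) :
    'M[R[i]]_n :=
  block_proj (N 0) *m Y *m block_proj (N 1) +
  block_proj (N 1) *m Y *m block_proj (N 0).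

Definition adjoint n (A : 'M[R[i]]_n) : 'M[R[i]]_n := map_mx Num.conj A^T.

End Matrices.

Section MarchenkoPastur.
Variable R : realType.

Definition narayana_number (k j : nat) : R :=
  j%:R^-1 * ('C(k.-1, j.-1))%:R * ('C(k, j.-1))%:R.

Definition narayana_poly (k : nat) (t : R) : R :=
  \sum_(1 <= j < k.+1) narayana_number k j * t ^+ j.

Definition mp_left (t : R) : R := (1 - Num.sqrt t) ^+ 2.
Definition mp_right (t : R) : R := (1 + Num.sqrt t) ^+ 2.

Definition mp_density (t x : R) : R :=
  (Num.sqrt ((x - mp_left t) * (mp_right t - x)) / (2 * pi * x))
    * \1_`[mp_left t, mp_right t] x.

Definition mp_continuous (t : R) : set R -> \bar R :=
  fun A => (\int[lebesgue_measure]_(x in A) (mp_density t x)%:E)%E.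

Lemma mp_density_ge0 t x : 0 <= mp_density t x.
Proof.
rewrite /mp_density indicE; have [|_] := boolP (x \in _); last by rewrite mulr0.
rewrite inE /= in_itv /= => /andP[ax _]; rewrite mulr1 divr_ge0 ?sqrtr_ge0//.
by rewrite !mulr_ge0 ?pi_ge0// (le_trans _ ax)// sqr_ge0.
Qed.

Lemma measurable_mp_density t : measurable_fun setT (mp_density t).
Proof.
rewrite (_ : mp_density t = fun x =>
    Num.sqrt ((x - mp_left t) * (mp_right t - x)) * ((2 * pi)^-1 * x `^ (-1))
      * \1_`[mp_left t, mp_right t] x); last first.
  apply/funext => x; rewrite /mp_density indicE.
  have [|_] := boolP (x \in _); last by rewrite !mulr0.
  rewrite inE /= in_itv /= => /andP[ax _].
  by rewrite powR_inv1 ?invfM// (le_trans _ ax)// sqr_ge0.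
apply: measurable_funM; last exact: measurable_indic.
apply: measurable_funM; last first.
  by apply: measurable_funM => //; exact: measurable_powR.
apply: measurableT_comp.
  exact: (continuous_measurable_fun (@sqrt_continuous R)).
by apply: measurable_funM; apply: measurable_funB.
Qed.

Section mp_continuous_measure.
Variable t : R.

Let mpc0 : mp_continuous t set0 = 0%E.
Proof. by rewrite /mp_continuous integral_set0. Qed.

Let mpc_ge0 A : (0 <= mp_continuous t A)%E.
Proof. by apply: integral_ge0 => x _; rewrite lee_fin mp_density_ge0. Qed.

Let mpc_sigma_additive : semi_sigma_additive (mp_continuous t).
Proof.
move=> A mA tA mUA; rewrite /mp_continuous ge0_integral_bigcup//=.
- apply: is_cvg_ereal_nneg_natsum_cond => n _ _.
  by apply: integral_ge0 => x _; rewrite lee_fin mp_density_ge0.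
- by apply: measurable_funTS; apply/measurable_EFinP;
     exact: measurable_mp_density.
- by move=> x _; rewrite lee_fin mp_density_ge0.
Qed.

HB.instance Definition _ := isMeasure.Build _ _ _
  (mp_continuous t) mpc0 mpc_ge0 mpc_sigma_additive.

End mp_continuous_measure.

Let max0_ge0 (x : R) : 0 <= Num.max x 0.
Proof. by rewrite le_max lexx orbT. Qed.

(* At t = 0 the interval [a, b] is the point 1, which is Lebesgue-null, so
   [marchenko_pastur 0] is the Dirac mass at 0. *)
Definition marchenko_pastur (t : R) : {measure set R -> \bar R} :=
  measure_add (mscale (NngNum (max0_ge0 (1 - t))) \d_(0 : R)) (mp_continuous t).

Definition dilation (lambda : R) (mu : {measure set R -> \bar R}) :
    set R -> \bar R := pushforward mu ( *%R lambda).

Section dilation_measure.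
Variables (lambda : R) (mu : {measure set R -> \bar R}).

Let dil_mfun : measurable_fun [set: R] ( *%R lambda).
Proof. exact: measurable_funM. Qed.

Let measurable_dil A : measurable A -> measurable (( *%R lambda) @^-1` A).
Proof. by move=> mA; rewrite -[X in measurable X]setTI; exact: dil_mfun. Qed.

Let dil0 : dilation lambda mu set0 = 0%E.
Proof. by rewrite /dilation /pushforward preimage_set0 measure0. Qed.

Let dil_ge0 A : (0 <= dilation lambda mu A)%E.
Proof. exact: measure_ge0. Qed.

Let dil_sigma_additive : semi_sigma_additive (dilation lambda mu).
Proof.
move=> F mF tF mUF; rewrite /dilation /pushforward preimage_bigcup.
apply: measure_semi_sigma_additive.
- by move=> n; exact: measurable_dil.
- apply/trivIsetP => /= i j _ _ ij; rewrite -preimage_setI.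
  by move/trivIsetP : tF => /(_ _ _ _ _ ij) ->//; rewrite preimage_set0.
- by rewrite -preimage_bigcup; exact: measurable_dil.
Qed.

HB.instance Definition _ := isMeasure.Build _ _ _
  (dilation lambda mu) dil0 dil_ge0 dil_sigma_additive.

End dilation_measure.

(* [tau k] is the sequence whose limit is to be the k-th moment. *)
Definition is_limit_distribution (tau : nat -> nat -> R[i])
    (mu : {measure set R -> \bar R}) : Prop :=
  (mu [set: R] = 1)%E /\
  forall k : nat, (0 < k)%N ->
    mu.-integrable [set: R] (fun x : R => (x ^+ k)%:E) /\
    (tau k : nat -> R[i]^o) @ \oo -->
      ((fine (\int[mu]_x (x ^+ k)%:E))%:C%C : R[i]^o).

End MarchenkoPastur.

(* Main.v *)
From HB Require Import structures.
Require Import Defs.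
From mathcomp Require Import ring lra zify.
From mathcomp Require mpoly.
Import -(notations) mpoly.

(** Only the entries of the N_1 x N_2 block X of Y contribute to the trace over
    N_1: there B B^* is W = X X^*.  For T_l the trace of W^l over N_1, Gaussian
    integration by parts applied to the leading entry of W^{k+1} = X (X^* W^k)
    expresses E[T_{k+1} T_{l_1} ... T_{l_r}] through expectations of products of
    traces of smaller total degree.  After division of every trace by n, the
    terms that merge two traces carry a factor n^-2, so by induction the expected
    products converge to products mu_{l_1} ... mu_{l_r}, where mu_0 = d_1 and
    mu_{k+1} = d_2 mu_k + sum_{l < k} mu_{l+1} mu_{k-1-l}.

    The rescaled sequence h_k = mu_k / d_1^{k+1} satisfies a quadratic recursion.
    Its generating function is algebraic of degree two, which yields a three-term
    linear recurrence; the Narayana polynomials and the moments of the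
    Marchenko-Pastur law satisfy the same recurrence, the former by a binomial
    identity, the latter by integrating the derivative of x^m Q(x)^{3/2} with
    Q(x) = (x - a)(b - x).

    Finally a measure with the moments of a compactly supported one has compact
    support, by Markov's inequality for high even moments, and the polynomials
    (1 - y^n)^{n 2^n} converge on [0, 1] to the indicator of [0, 1/2[, so that
    the moments determine the measures of all half lines. *)

Set Implicit Arguments.
Unset Strict Implicit.
Unset Printing Implicit Defensive.

Import HBNNSimple.

Local Open Scope classical_set_scope.
Local Open Scope ring_scope.

(** * Calculus on the real line *)

(** A single expected trace obeys no closed recursion: integration by parts turns it into
    expectations of products of two traces, and in such a product the derivative also hits the other
    factor. Carrying arbitrary lists of traces closes the system, and the factorization of the limit
    comes out of the same induction, without a separate variance estimate. Integration by parts is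
    needed only for polynomials in the real and imaginary parts of the entries. They are kept as
    formal multivariate polynomials, so that derivatives are algebraic and the identity reduces, on
    monomials, to a recursion between one-dimensional moments. The linear recurrence compares
    moments that satisfy it for unrelated reasons, and it leaves only the first moment to be
    matched. The total mass is out of its reach, since the factor 1/x of the density survives there;
    it needs an antiderivative of its own and, at t = 1, an improper integral. Uniqueness is claimed
    among all measures, whose support is not known in advance; this is why bounded support is
    extracted from the moments before any polynomial approximation. *)

Section Calculus.
Variable R : realType.
Implicit Types (f g F : R -> R) (x a b c : R).
Notation mu := (@lebesgue_measure R).

Lemma is_derive_mul f g x a b : is_derive x 1 f a -> is_derive x 1 g b ->
  is_derive x 1 (fun z => f z * g z) (a * g x + f x * b).
Proof.
move=> df dg; apply: (is_derive_eq (is_deriveM df dg)).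
by rewrite addrC (mulrC a).
Qed.

Lemma is_derive_add f g x a b : is_derive x 1 f a -> is_derive x 1 g b ->
  is_derive x 1 (fun z => f z + g z) (a + b).
Proof. by move=> df dg; exact: (is_deriveD df dg). Qed.

Lemma is_derive_scale f x a c : is_derive x 1 f a ->
  is_derive x 1 (fun z => c * f z) (c * a).
Proof.
move=> df; apply: (is_derive_eq (is_derive_mul (is_derive_cst c x 1) df)).
by rewrite mul0r add0r.
Qed.

Lemma is_derive_shift c x : is_derive x 1 (fun z : R => z - c) 1.
Proof.
apply: (is_derive_eq (is_derive_add (is_derive_id x 1) (is_derive_cst (- c) x 1))).
by rewrite addr0.
Qed.

Lemma is_derive_pow k x : is_derive x 1 (fun z : R => z ^+ k) (k%:R * x ^+ k.-1).
Proof.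
have -> : (fun z : R => z ^+ k) = (fun z : R => z) ^+ k.
  by apply/funext => z; rewrite fctE.
by apply: (is_derive_eq (is_deriveX k (is_derive_id x (1 : R)))); rewrite scaler1.
Qed.

Lemma is_derive_comp1 f g x a b : is_derive (g x) 1 f a -> is_derive x 1 g b ->
  is_derive x 1 (fun z => f (g z)) (a * b).
Proof. exact: is_derive1_comp. Qed.

Lemma is_derive_continuous f x a : is_derive x 1 f a -> {for x, continuous f}.
Proof.
by move=> [df _]; apply: differentiable_continuous; apply/derivable1_diffP.
Qed.

(** Differentiability is asked only inside the interval, because the antiderivatives used later
    contain square roots that have no derivative at the end points. *)
Lemma integral_is_derive F f a b : a < b ->
  {within `[a, b], continuous F} ->
  {within `[a, b], continuous f} ->
  (forall x, a < x < b -> is_derive x 1 F (f x)) ->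
  (\int[mu]_(x in `[a, b]) (f x)%:E)%E = (F b - F a)%:E.
Proof.
move=> ab cF cf dF.
have /(continuous_within_itvP _ ab)[_ Fa Fb] := cF.
rewrite (continuous_FTC2 ab cf (F := F)) ?EFinB//.
- split=> // x; rewrite in_itv/= => xab.
  by have [] := dF x xab.
- move=> x; rewrite in_itv/= => xab; rewrite derive1E.
  by have [_ ->] := dF x xab.
Qed.

End Calculus.

(** * Integration against the image of a measure with density *)

Section ImageDensity.
Context (d1 d2 : measure_display) (T : measurableType d1) (S : measurableType d2).
Context (R : realType).
Variables (mu : {measure set T -> \bar R}) (nu : {measure set S -> \bar R}).
Variables (phi : T -> S) (h : T -> R).
Hypotheses (mphi : measurable_fun setT phi) (mh : measurable_fun setT h).
Hypothesis h0 : forall x, 0 <= h x.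
Hypothesis nuE : forall A, measurable A ->
  nu A = (\int[mu]_(x in phi @^-1` A) (h x)%:E)%E.

(** On indicators this is [nuE]; simple functions follow by linearity and the rest by monotone
    convergence. The case [h = 1] is the image of a measure, the case [phi = id] a measure with
    density; independence uses both features at once. *)
Lemma ge0_integral_density (g : S -> \bar R) : measurable_fun setT g ->
  (forall x, 0 <= g x)%E ->
  (\int[nu]_x g x = \int[mu]_x (g (phi x) * (h x)%:E))%E.
Proof.
move=> mg g0.
have mpre A : measurable A -> measurable (phi @^-1` A).
  by move=> mA; rewrite -[X in measurable X]setTI; exact: mphi.
pose g_ n : {nnsfun S >-> R} := nnsfun_approx measurableT mg n.
have cg x : (EFin \o g_ ^~ x) @ \oo --> g x.
  by apply: (cvg_nnsfun_approx measurableT mg) => //.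
have ndg x : {homo g_ ^~ x : n m / (n <= m)%N >-> n <= m}.
  by move=> n m nm; have /lefP := nd_nnsfun_approx measurableT mg nm; exact.
have simple (f : {nnsfun S >-> R}) :
    (\int[nu]_x (f x)%:E = \int[mu]_x ((f (phi x))%:E * (h x)%:E))%E.
  rewrite integralT_nnsfun sintegralE.
  transitivity (\int[mu]_x (\sum_(y \in range f)
     (y%:E * ((\1_(phi @^-1` (f @^-1` [set y])) x)%:E * (h x)%:E))))%E; last first.
    apply: eq_integral => x _.
    rewrite [in RHS](fimfunE f (phi x)) -fsumEFin//.
    rewrite ge0_mule_fsuml; last first.
      by move=> y; rewrite EFinM; exact: nnfun_muleindic_ge0.
    by apply: eq_fsbigr => y _; rewrite EFinM muleA.
  rewrite ge0_integral_fsum//; last 2 first.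
  - move=> y; apply/measurable_EFinP; apply: measurable_funM => //.
    apply: measurable_funM => //; apply: measurable_indic; apply: mpre.
    exact: measurable_sfunP.
  (* A negative [y] is not a value of [f], so its indicator is zero. *)
  - move=> y x _; have [y0|y0] := leP 0 y.
      by rewrite !mule_ge0// lee_fin ?h0.
    rewrite indicE (_ : x \in _ = false) ?mul0e ?mule0//.
    apply/negbTE/negP; rewrite inE/= => e.
    by move: y0; rewrite -e ltNge fun_ge0.
  apply: eq_fsbigr => y; rewrite inE => -[z _ yE].
  have mA : measurable (f @^-1` [set y]) by exact: measurable_sfunP.
  rewrite nuE// ge0_integralZl//; last 3 first.
  - apply/measurable_EFinP; apply: measurable_funM => //.
    by apply: measurable_indic; exact: mpre.
  - by move=> x _; rewrite mule_ge0// lee_fin.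
  - by rewrite lee_fin -yE fun_ge0.
  congr (_ * _)%E; rewrite integral_mkcond; apply: eq_integral => x _.
  by rewrite patchE indicE; case: ifPn => _; rewrite ?mul1e ?mul0e.
rewrite (@nd_ge0_integral_lim _ _ _ nu g g_)//.
transitivity (\int[mu]_x (limn (fun n => (g_ n (phi x))%:E * (h x)%:E)))%E; last first.
  apply: eq_integral => x _; apply/cvg_lim => //.
  by apply: cvgeZr => //; exact: cg.
rewrite monotone_convergence//.
- by congr (limn _); apply/funext => n /=; rewrite -simple integralT_nnsfun.
- move=> n; apply/measurable_EFinP; apply: measurable_funM => //.
  by apply: measurableT_comp.
- by move=> n x _; rewrite mule_ge0// lee_fin.
- move=> x _ n m nm; rewrite lee_wpmul2r ?lee_fin//; exact: ndg.
Qed.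

Lemma integrable_density (g : S -> R) : measurable_fun setT g ->
  nu.-integrable setT (EFin \o g) <->
  mu.-integrable setT (fun x => (g (phi x) * h x)%:E).
Proof.
move=> mg; have mg' : measurable_fun setT (EFin \o g) by exact/measurable_EFinP.
have e : (\int[nu]_x `|(g x)%:E| = \int[mu]_x `|(g (phi x) * h x)%:E|)%E.
  rewrite ge0_integral_density//; last exact: measurableT_comp.
  by apply: eq_integral => x _ /=; rewrite normrM (ger0_norm (h0 _)).
split => /integrableP[_ ifin]; apply/integrableP; split => //.
- apply/measurable_EFinP; apply: measurable_funM => //.
  exact: measurableT_comp.
- by rewrite -e.
- by rewrite e.
Qed.

(** Multiplication by [h >= 0] commutes with positive and negative parts, so both integrals split in
    the same way. *)
Lemma integral_density (g : S -> R) : measurable_fun setT g ->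
  \int[nu]_x g x = \int[mu]_x (g (phi x) * h x).
Proof.
move=> mg; rewrite /Rintegral; congr fine.
have mg' : measurable_fun setT (EFin \o g) by exact/measurable_EFinP.
rewrite integralE [RHS]integralE; congr (_ - _)%E.
- rewrite ge0_integral_density//; last exact: measurable_funepos.
  apply: eq_integral => x _; rewrite !funeposE.
  by rewrite -!EFin_max -EFinM maxr_pMl// mul0r.
- rewrite ge0_integral_density//; last exact: measurable_funeneg.
  apply: eq_integral => x _; rewrite !funenegE.
  by rewrite -!EFinN -!EFin_max -EFinM maxr_pMl// mul0r mulNr.
Qed.

End ImageDensity.

(** * Independence *)

Section Independence.
Context (disp : measure_display) (T : measurableType disp) (R : realType).
Variables (P : probability T R) (I : finType) (X : I -> T -> R).
Hypothesis mX : forall i, measurable_fun setT (X i).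
Hypothesis indX : mutually_independent P X.

Let mprod (g : I -> R -> R) (Q : pred I) : (forall i, measurable_fun setT (g i)) ->
  measurable_fun setT (fun w => \prod_(i | Q i) g i (X i w)).
Proof.
move=> mg; rewrite (_ : (fun w => _) =
   (fun w => \prod_(i <- [seq i <- index_enum I | Q i]) g i (X i w))); last first.
  by apply/funext => w; rewrite big_filter.
by apply: measurable_prod => i _; exact: measurableT_comp.
Qed.

Let upd (g : I -> R -> R) i0 (u : R -> R) i := if i == i0 then u else g i.

Let prod_upd g i0 u w :
  \prod_i upd g i0 u i (X i w) = u (X i0 w) * \prod_(i | i != i0) g i (X i w).
Proof.
rewrite (bigD1 i0)//= /upd eqxx; congr (_ * _).
by apply: eq_bigr => i /negbTE ->.
Qed.

Let Eindic B : measurable B -> (\int[P]_w (\1_B w)%:E = P B)%E.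
Proof. by move=> mB; rewrite integral_indic// setIT. Qed.

Let mXpre i A : measurable A -> measurable (X i @^-1` A).
Proof. by move=> mA; rewrite -[X in measurable X]setTI; exact: mX. Qed.

(** The factors are turned from indicators into general functions one index at a time. When all are
    indicators, the claim is the definition of independence for the full index set. *)
Lemma ge0_independent_prod (g : I -> R -> R) (e : I -> R) :
  (forall i, measurable_fun setT (g i)) -> (forall i x, 0 <= g i x) ->
  (forall i, \int[P]_w (g i (X i w))%:E = (e i)%:E)%E ->
  (\int[P]_w (\prod_i g i (X i w))%:E = (\prod_i e i)%:E)%E.
Proof.
(* The induction runs over a list containing every index whose factor may fail to be an indicator;
   [enum I] is the case without restriction. *)
have : forall i, i \notin enum I -> exists A, measurable A /\ g i = \1_A.
  by move=> i; rewrite mem_enum.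
elim: (enum I) g e => [|i0 s IH] g e gA mg g0 ge.
  have /boolp.choice[A HA] : forall i, exists A, measurable A /\ g i = \1_A.
    by move=> i; exact: gA.
  have mA i : measurable (A i) by case: (HA i).
  transitivity (P (\bigcap_(i in [set` [set: I]%SET]) (X i @^-1` A i))).
    rewrite -Eindic; last first.
      by apply: fin_bigcap_measurable => // i _; exact: mXpre.
    apply: eq_integral => w _; congr EFin.
    rewrite indicE; have [/set_mem wA|/negP wA] := boolP (w \in _).
      rewrite big1// => i _; have [_ ->] := HA i; rewrite indicE mem_set//.
      by apply: wA; rewrite /= inE.
    have [i wi] : exists i, ~ A i (X i w).
      by apply/existsNP => wA'; apply: wA; rewrite inE => i _; exact: wA'.
    by rewrite (bigD1 i)//=; have [_ ->] := HA i; rewrite indicE memNset// mul0r.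
  rewrite indX//; rewrite [LHS](eq_bigl predT); last by move=> i; rewrite finset.in_setT.
  rewrite [LHS](eq_bigr (fun i => (e i)%:E)); first by rewrite prodEFin.
  move=> i _; rewrite -ge; have [_ ->] := HA i.
  by rewrite -Eindic//; exact: mXpre.
have e0 i : 0 <= e i.
  by rewrite -lee_fin -ge; apply: integral_ge0 => w _; rewrite lee_fin.
have c0 : 0 <= \prod_(i | i != i0) e i by apply: prodr_ge0.
pose mixin := isMeasurableFun.Build _ _ _ _ _ (mX i0).
pose Xi : {mfun T >-> R} := HB.pack (X i0) mixin.
pose nu := mscale (NngNum c0) (distribution P Xi).
have IHu (u : R -> R) (eu : R) : measurable_fun setT u -> (forall x, 0 <= u x) ->
    (exists A, measurable A /\ u = \1_A) ->
    (\int[P]_w (u (X i0 w))%:E = eu%:E ->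
    \int[P]_w (u (X i0 w) * \prod_(i | i != i0) g i (X i w))%:E =
      (eu * \prod_(i | i != i0) e i)%:E)%E.
  move=> mu u0 uA ue.
  under eq_integral do rewrite -prod_upd.
  rewrite (IH _ (fun i => if i == i0 then eu else e i)).
  - rewrite (bigD1 i0)//= eqxx; congr (_ * _)%:E.
    by apply: eq_bigr => i /negbTE ->.
  - move=> i si; rewrite /upd; case: eqP => // /eqP ii0; apply: gA.
    by rewrite inE negb_or ii0.
  - by move=> i; rewrite /upd; case: eqP.
  - by move=> i x; rewrite /upd; case: eqP.
  - by move=> i; rewrite /upd; case: eqP => // ->.
(* The rescaled law of [X i0] agrees with the measure that weights the event [X i0 \in A] by the
   other factors: with an indicator at [i0] the induction hypothesis applies. The function [g i0]
   can then be integrated against either measure. *)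
have nuE A : measurable A -> nu A =
   (\int[P]_(w in X i0 @^-1` A) (\prod_(i | i != i0) g i (X i w))%:E)%E.
  move=> mA; rewrite integral_mkcond.
  have mXA : measurable (X i0 @^-1` A).
    exact: mXpre.
  transitivity (\int[P]_w (\1_A (X i0 w) * \prod_(i | i != i0) g i (X i w))%:E)%E.
    rewrite (IHu _ (fine (P (X i0 @^-1` A)))).
    - by rewrite EFinM fineK ?fin_num_measure// muleC.
    - exact: measurable_indic.
    - by move=> x; rewrite indicE.
    - by exists A.
    - rewrite fineK ?fin_num_measure//.
      by rewrite -Eindic.
  apply: eq_integral => w _; rewrite patchE indicE.
  rewrite (_ : (X i0 w \in A) = (w \in X i0 @^-1` A))//.
  by case: ifP => _; rewrite ?mul1r ?mul0r.
under eq_integral do rewrite (bigD1 i0)//= EFinM.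
rewrite -(@ge0_integral_density _ _ _ _ _ P nu (X i0)
  (fun w => \prod_(i | i != i0) g i (X i w)) _ _ _ nuE (EFin \o g i0))//.
- rewrite ge0_integral_mscale//; last 2 first.
  + exact/measurable_EFinP.
  + by move=> x _; rewrite lee_fin.
  rewrite ge0_integral_distribution//; last 2 first.
  + exact/measurable_EFinP.
  + by move=> x; rewrite lee_fin.
  by rewrite ge -EFinM [in RHS](bigD1 i0)//= mulrC.
- exact: mprod.
- by move=> w; apply: prodr_ge0.
- exact/measurable_EFinP.
- by move=> x; rewrite lee_fin.
Qed.

Lemma integrable_independent_prod (g : I -> R -> R) :
  (forall i, measurable_fun setT (g i)) ->
  (forall i, P.-integrable setT (fun w => (g i (X i w))%:E)) ->
  P.-integrable setT (fun w => (\prod_i g i (X i w))%:E).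
Proof.
move=> mg ig; apply/integrableP; split.
  by apply/measurable_EFinP; exact: mprod.
under eq_integral do rewrite /= normr_prod.
rewrite (@ge0_independent_prod (fun i x => `|g i x|)
   (fun i => \int[P]_w `|g i (X i w)|)) ?ltry//.
- by move=> i; apply: measurableT_comp.
- move=> i; rewrite fineK//; apply: integrable_fin_num => //.
  exact: (integrable_norm (ig i)).
Qed.

(** Signs are removed one index at a time: [g i0] is the difference of its positive and negative
    parts, and both sides are linear in that factor. *)
Lemma Rintegral_independent_prod (g : I -> R -> R) :
  (forall i, measurable_fun setT (g i)) ->
  (forall i, P.-integrable setT (fun w => (g i (X i w))%:E)) ->
  \int[P]_w (\prod_i g i (X i w)) = \prod_i \int[P]_w g i (X i w).
Proof.
have : forall i, i \notin enum I -> forall x, 0 <= g i x.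
  by move=> i; rewrite mem_enum.
elim: (enum I) g => [|i0 s IH] g g0 mg ig.
  rewrite /Rintegral (@ge0_independent_prod g (fun i => \int[P]_w g i (X i w)))//.
    by move=> i x; exact: g0.
  by move=> i; rewrite fineK//; exact: integrable_fin_num.
pose gp := fun x => Num.max (g i0 x) 0; pose gn := fun x => Num.max (- g i0 x) 0.
have gpn x : g i0 x = gp x - gn x.
  rewrite /gp /gn; have [h|h] := leP (g i0 x) 0.
    by rewrite (max_idPl _) ?oppr_ge0// sub0r opprK.
  by rewrite (max_idPr _) ?oppr_le0 ?(ltW h)// subr0.
have mgp : measurable_fun setT gp by apply: measurable_maxr.
have mgn : measurable_fun setT gn.
  by apply: measurable_maxr => //; apply: measurableT_comp.
have dom (u : R -> R) : measurable_fun setT u -> (forall x, `|u x| <= `|g i0 x|) ->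
    P.-integrable setT (fun w => (u (X i0 w))%:E).
  move=> mu ug; apply: le_integrable (ig i0) => //.
    by apply/measurable_EFinP; exact: measurableT_comp.
  by move=> w _ /=; rewrite lee_fin.
have igp : P.-integrable setT (fun w => (gp (X i0 w))%:E).
  apply: dom => // x; rewrite /gp; have [h|h] := leP (g i0 x) 0 => //.
  by rewrite normr0.
have ign : P.-integrable setT (fun w => (gn (X i0 w))%:E).
  apply: dom => // x; rewrite /gn; have [h|h] := leP (- g i0 x) 0; last by rewrite normrN.
  by rewrite normr0.
have IHu (u : R -> R) : measurable_fun setT u -> (forall x, 0 <= u x) ->
    P.-integrable setT (fun w => (u (X i0 w))%:E) ->
    P.-integrable setT (fun w => (u (X i0 w) * \prod_(i | i != i0) g i (X i w))%:E) /\
    \int[P]_w (u (X i0 w) * \prod_(i | i != i0) g i (X i w)) =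
    (\int[P]_w u (X i0 w)) * \prod_(i | i != i0) \int[P]_w g i (X i w).
  move=> mu u0 iu.
  have mupd i : measurable_fun setT (upd g i0 u i) by rewrite /upd; case: eqP.
  have iupd i : P.-integrable setT (fun w => (upd g i0 u i (X i w))%:E).
    by rewrite /upd; case: eqP => // ->.
  split.
    rewrite (_ : (fun w => _) = (fun w => (\prod_i upd g i0 u i (X i w))%:E)).
      exact: integrable_independent_prod.
    by apply/funext => w; rewrite prod_upd.
  under eq_Rintegral do rewrite -prod_upd.
  rewrite IH//.
    rewrite (bigD1 i0)//= {1}/upd eqxx; congr (_ * _).
    by apply: eq_bigr => i /negbTE ii0; rewrite /upd ii0.
  move=> i si x; rewrite /upd; case: eqP => // /eqP ii0; apply: g0.
  by rewrite inE negb_or ii0.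
have gp0 x : 0 <= gp x by rewrite /gp le_max lexx orbT.
have gn0 x : 0 <= gn x by rewrite /gn le_max lexx orbT.
have [ip Ep] := IHu gp mgp gp0 igp.
have [in_ En] := IHu gn mgn gn0 ign.
under eq_Rintegral do rewrite (bigD1 i0)//= gpn mulrBl.
rewrite RintegralB// Ep En -mulrBl [RHS](bigD1 i0)//=; congr (_ * _).
rewrite -RintegralB//; apply: eq_Rintegral => w _; by rewrite gpn.
Qed.

End Independence.

(** * Gaussian integration by parts *)

Section Gaussian.
Variable R : realType.
Notation mu := (@lebesgue_measure R).

Lemma expR_ge_pow (y : R) k : 0 <= y -> y ^+ k <= k`!%:R * expR y.
Proof.
case: k => [|k] y0.
  rewrite expr0 fact0 mul1r.
  by rewrite (le_trans _ (expR_ge1Dx y))// lerDl.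
have f0 : 0 < k.+1`!%:R :> R by rewrite ltr0n fact_gt0.
rewrite mulrC -ler_pdivrMr//.
by rewrite (le_trans _ (expR_ge1Dxn k y0))// lerDr.
Qed.

(* A power of y = x^2 / (2 s^2) is absorbed by expR (3 y / 4), which leaves
   expR (- y / 4), the density of standard deviation 2 s. *)
Lemma pow_normal_pdf_le (s : R) k : 0 < s -> exists C : R, forall x,
  `|x ^+ k * normal_pdf 0 s x| <= C * normal_pdf 0 (2 * s) x.
Proof.
move=> s0; have ns0 : s != 0 by rewrite gt_eqF.
have ns20 : 2 * s != 0 by rewrite mulf_neq0.
pose c := normal_peak s; pose c2 := normal_peak (2 * s).
have c0 : 0 <= c by rewrite normal_peak_ge0.
have c20 : 0 < c2 by rewrite normal_peak_gt0.
(* From |x|^k <= 1 + (x^2)^k, x^2 = 2 s^2 (4/3) (3y/4) and z^k <= k! exp z at z = 3y/4. The quotient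
   of the two peaks in the witness changes the normalization from s to 2 s. *)
pose A := 1 + (s ^+ 2 *+ 2) ^+ k * (4 / 3) ^+ k * k`!%:R.
exists (c * A / c2) => x.
rewrite !normal_pdfE//= /normal_fun !subr0.
set y := x ^+ 2 / (s ^+ 2 *+ 2).
have s2 : 0 < s ^+ 2 *+ 2 by rewrite pmulrn_lgt0// exprn_gt0.
have y0 : 0 <= y by rewrite divr_ge0 ?sqr_ge0// ltW.
have -> : - x ^+ 2 / (s ^+ 2 *+ 2) = - y by rewrite mulNr.
have -> : - x ^+ 2 / ((2 * s) ^+ 2 *+ 2) = 3 / 4 * y - y.
  by rewrite /y; field.
rewrite -/c -/c2 (_ : c * A / c2 * _ = c * A * expR (3 / 4 * y - y)); last first.
  by field; rewrite gt_eqF.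
rewrite mulrCA normrM (ger0_norm c0) -mulrA ler_wpM2l//.
rewrite normrM (ger0_norm (expR_ge0 _)) expRD mulrA ler_wpM2r ?expR_ge0//.
have e1 : 1 <= expR (3 / 4 * y).
  by rewrite -[leLHS]expR0 ler_expR mulr_ge0// divr_ge0.
have y34 : 0 <= 3 / 4 * y by rewrite mulr_ge0// divr_ge0.
apply: (@le_trans _ _ (1 + (x ^+ 2) ^+ k)).
  rewrite normrX; have [x1|x1] := leP `|x| 1.
    by rewrite (le_trans (exprn_ile1 _ (normr_ge0 x) x1))// lerDl exprn_ge0 ?sqr_ge0.
  rewrite -(real_normK (num_real x)) exprAC ler_wpDl//.
  by rewrite expr2 ler_peMr ?exprn_ge0// exprn_ege1 ?ltW.
rewrite mulrDl mul1r lerD//.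
have -> : x ^+ 2 = (s ^+ 2 *+ 2) * (4 / 3) * (3 / 4 * y).
  by rewrite /y; field; rewrite ?gt_eqF.
have := expR_ge_pow k y34; move: (3 / 4 * y) => z hz.
rewrite 2!exprMn -(mulrA (_ * _) _ (expR z)) ler_wpM2l//.
by rewrite mulr_ge0// exprn_ge0// ?divr_ge0// ltW.
Qed.

Lemma integrable_pow_normal_pdf (s : R) k : 0 < s ->
  mu.-integrable setT (fun x => (x ^+ k * normal_pdf 0 s x)%:E).
Proof.
move=> s0; have [C hC] := pow_normal_pdf_le k s0.
have iC : mu.-integrable setT (fun x => C%:E * (normal_pdf 0 (2 * s) x)%:E)%E.
  by apply: integrableZl => //; exact: integrable_normal_pdf.
apply: le_integrable iC => //.
- apply/measurable_EFinP; apply: measurable_funM; first exact: exprn_measurable.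
  exact: measurable_normal_pdf.
- move=> x _; rewrite -EFinM !abse_EFin lee_fin.
  by rewrite (le_trans (hC x))// ler_norm.
Qed.

Lemma cvg_integral_sym_itv (f : R -> R) : mu.-integrable setT (EFin \o f) ->
  (fun n : nat => \int[mu]_(x in `[(- n%:R)%R, n%:R%R]) (f x)%:E)%E @ \oo -->
  (\int[mu]_x (f x)%:E)%E.
Proof.
move=> intf; have mf : measurable_fun setT (EFin \o f) by case/integrableP: intf.
pose f_ (n : nat) := (EFin \o f) \_ `[- n%:R, n%:R].
have [] := @dominated_convergence _ _ R mu setT measurableT f_ (EFin \o f)
  (abse \o (EFin \o f)).
- move=> n; apply/(measurable_restrictT _ _).1 => //.
  exact: measurable_funTS.
- by [].
- apply: aeW => x _; apply: cvg_near_cst; near=> n.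
  rewrite /f_ patchE mem_set//= in_itv/= -ler_norml.
  by near: n; exact: nbhs_infty_ger.
- exact: integrable_abse.
- apply: aeW => x n _; rewrite /f_ patchE; case: ifP => // _.
  by rewrite abse0 abse_ge0.
move=> _ _; rewrite (_ : [sequence _]_n =
  (fun n : nat => \int[mu]_(x in `[(- n%:R)%R, n%:R%R]) (f x)%:E)%E)//.
by apply/funext => n; rewrite [RHS]integral_mkcond.
Unshelve. all: by end_near. Qed.

Lemma is_derive_pow_normal_pdf (s : R) (k : nat) (x : R) : 0 < s ->
  is_derive x (1 : R) (fun x : R => x ^+ k * normal_pdf 0 s x)
    (k%:R * (x ^+ k.-1 * normal_pdf 0 s x)
     - (s ^+ 2)^-1 * (x ^+ k.+1 * normal_pdf 0 s x)).
Proof.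
move=> s0; have ns0 : s != 0 by rewrite gt_eqF.
rewrite normal_pdfE// /normal_fun.
have -> : (fun x => x ^+ k * (normal_peak s * expR (- (x - 0) ^+ 2 / (s ^+ 2 *+ 2))))
   = (fun x => x ^+ k * (normal_peak s * expR ((- (s ^+ 2 *+ 2)^-1) * x ^+ 2))).
  by apply/funext => z; congr (_ * (_ * expR _)); rewrite subr0; ring.
apply: (is_derive_eq (is_derive_mul (is_derive_pow k x)
  (is_derive_scale (normal_peak s) (is_derive_comp1 (is_derive_expR _)
    (is_derive_scale (- (s ^+ 2 *+ 2)^-1) (is_derive_pow 2 x)))))).
have -> : - (s ^+ 2 *+ 2)^-1 * x ^+ 2 = - (x - 0) ^+ 2 / (s ^+ 2 *+ 2).
  by rewrite subr0; ring.
by move: (expR _) => E; rewrite (exprS x k) /= expr1; field.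
Qed.

(** The integrand is the derivative of x^k times the density, so its integral over [-n, n] is a
    difference of boundary values that tend to 0. For k = 0 the exponent [k.-1] is harmless, its
    coefficient being 0. *)
Lemma normal_pdf_by_parts (s : R) k : 0 < s ->
  (\int[mu]_x (k%:R * (x ^+ k.-1 * normal_pdf 0 s x)
     - (s ^+ 2)^-1 * (x ^+ k.+1 * normal_pdf 0 s x))%:E = 0)%E.
Proof.
move=> s0; have ns0 : s != 0 by rewrite gt_eqF.
set D := fun x : R => k%:R * (x ^+ k.-1 * normal_pdf 0 s x)
     - (s ^+ 2)^-1 * (x ^+ k.+1 * normal_pdf 0 s x).
rewrite -[LHS]/(\int[mu]_x (D x)%:E)%E.
pose G (x : R) := x ^+ k * normal_pdf 0 s x.
have GD (x : R) : is_derive x (1 : R) G (D x) by exact: is_derive_pow_normal_pdf.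
have cG : continuous G by move=> x; exact: is_derive_continuous (GD x).
have cD : continuous D.
  move=> x; apply: is_derive_continuous.
  by apply: is_derive_add; [|rewrite /=]; last (apply: is_deriveN);
    apply: is_derive_scale; exact: is_derive_pow_normal_pdf.
have iD : mu.-integrable setT (EFin \o D).
  rewrite (_ : EFin \o D = (fun x => k%:R%:E * (x ^+ k.-1 * normal_pdf 0 s x)%:E
     - ((s ^+ 2)^-1)%:E * (x ^+ k.+1 * normal_pdf 0 s x)%:E)%E)//.
  by apply: integrableB => //; apply: integrableZl => //; exact: integrable_pow_normal_pdf.
have lim := cvg_integral_sym_itv iD.
apply: (cvg_unique _ lim) => //.
have [C hC] := pow_normal_pdf_le k.+1 s0.
(* Boundedness of x G(x) by [K] gives G(n) and G(-n) of order 1/n. *)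
pose K := C * normal_peak (2 * s).
have GK x : `|x * G x| <= `|K|.
  rewrite /G mulrA -exprS (le_trans (hC x))// (le_trans (ler_norm _))//.
  rewrite !normrM ler_wpM2l// !ger0_norm ?normal_pdf_ge0 ?normal_peak_ge0//.
  by rewrite normal_pdf_ub// mulf_neq0.
have GK0 (u : R ^nat) : (forall n, `|u n| = n%:R) -> (G \o u) @ \oo --> (0 : R).
  move=> un; apply/norm_cvg0P; apply: (@squeeze_cvgr _ _ _ _ (cst 0) (fun n => `|K| * n%:R^-1)).
  - near=> n; rewrite normr_ge0/= ler_pdivlMr ?ltr0n; last by near: n; exists 1%N.
    by rewrite mulrC -{1}un -normrM.
  - exact: cvg_cst.
  - rewrite -[X in _ --> X](mulr0 `|K|); apply: cvgMr.
    by rewrite -cvg_shiftS; exact: cvg_harmonic.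
have -> : 0%E = (0 - 0)%:E :> \bar R by rewrite subrr.
apply: (@cvg_trans _ ((fun n : nat => (G n%:R - G (- n%:R))%:E) @ \oo)).
  apply: near_eq_cvg; near=> n; rewrite (@integral_is_derive _ G D)//.
  - have n0 : 0 < n%:R :> R by rewrite ltr0n; near: n; exists 1%N.
    by rewrite (@lt_trans _ _ 0)// oppr_lt0.
  - exact: continuous_subspaceT.
  - exact: continuous_subspaceT.
apply: cvg_EFin; first by near=> n.
apply: cvgB; apply: GK0 => n; by rewrite ?normrN normr_nat.
Unshelve. all: by end_near. Qed.

End Gaussian.

Section GaussianMoments.
Context (disp : measure_display) (T : measurableType disp) (R : realType).
Variable P : probability T R.

(** Integration by parts for the monomial x^k; k = 0 says that the mean is zero. Variance 0 is a
    Dirac mass and is treated apart, since it has no density. *)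
Lemma centered_gaussian_moments (X : T -> R) (s2 : R) : 0 <= s2 ->
  is_centered_gaussian P X s2 ->
  (forall k, P.-integrable setT (fun w => (X w ^+ k)%:E)) /\
  (forall k, \int[P]_w (X w ^+ k.+1) = k%:R * s2 * \int[P]_w (X w ^+ k.-1)).
Proof.
move=> s20 [mX lawX].
have mk k : @measurable_fun _ _ (measurableTypeR R) R setT (fun x : R => x ^+ k).
  exact: exprn_measurable.
(* Moments of [X] are moments of its law, whether this law is the Dirac mass or the normal one. *)
have transfer (nu : {measure set (measurableTypeR R) -> \bar R}) :
    (forall A, measurable A -> P (X @^-1` A) = nu A) ->
    (forall k, nu.-integrable setT (fun x : R => (x ^+ k)%:E)) ->
    (forall k, P.-integrable setT (fun w => (X w ^+ k)%:E)) /\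
    (forall k, \int[P]_w (X w ^+ k) = \int[nu]_x (x ^+ k)).
  move=> nuX inu.
  have nuE A : measurable A -> nu A = (\int[P]_(x in X @^-1` A) (cst 1 x)%:E)%E.
    move=> mA; have mXA : measurable (X @^-1` A).
      by rewrite -[X in measurable X]setTI; exact: mX.
    transitivity (\int[P]_(x in X @^-1` A) cst 1%E x)%E => //.
    by rewrite integral_cst// mul1e; apply/esym/nuX.
  have mX' : @measurable_fun _ _ T (measurableTypeR R) setT X := mX.
  have m1 : measurable_fun [set: T] (cst 1 : T -> R) by exact: measurable_cst.
  have p1 (w : T) : 0 <= (cst 1 : T -> R) w by exact: ler01.
  split=> k.
    have := (integrable_density mX' m1 p1 nuE (mk k)).1 (inu k).
    by apply: eq_integrable => // w _; rewrite mulr1.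
  rewrite (integral_density mX' m1 p1 nuE (mk k)).
  by apply: eq_Rintegral => w _; rewrite mulr1.
move: lawX; rewrite /centered_gaussian_law; case: eqP => [->|/eqP s2n0] lawX.
  have [//|ik Ek] := transfer (dirac (0 : measurableTypeR R)) lawX.
    move=> k; apply/integrableP; split.
      by apply/measurable_EFinP; exact: exprn_measurable.
    rewrite integral_dirac//; first by rewrite diracT mul1e ltry.
    by apply/measurable_EFinP; apply: measurableT_comp => //; exact: exprn_measurable.
  split=> // k; rewrite Ek mulr0 mul0r /Rintegral integral_dirac//.
    by rewrite diracT mul1e expr0n.
  by apply/measurable_EFinP; exact: exprn_measurable.
pose s := Num.sqrt s2.
have s2_gt0 : 0 < s2 by rewrite lt_neqAle eq_sym s2n0.
have s0 : 0 < s by rewrite sqrtr_gt0.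
have ss : s ^+ 2 = s2 by rewrite sqr_sqrtr.
pose mu := @lebesgue_measure R.
have mpdf : @measurable_fun _ _ (measurableTypeR R) R setT (normal_pdf 0 s).
  exact: measurable_normal_pdf.
have mid : @measurable_fun _ _ (measurableTypeR R) (measurableTypeR R) setT id.
  exact: measurable_id.
have pdf0 x : 0 <= normal_pdf 0 s x := normal_pdf_ge0 0 s x.
have nuE A : measurable A -> normal_prob 0 s A =
    (\int[mu]_(x in id @^-1` A) (normal_pdf 0 s x)%:E)%E by [].
have [|ik Ek] := transfer (normal_prob 0 s) lawX.
  move=> k; apply/(integrable_density mid mpdf pdf0 nuE (mk k)).
  exact: integrable_pow_normal_pdf.
split=> // k; rewrite !Ek.
rewrite !(integral_density mid mpdf pdf0 nuE (mk _)).
have i1 := integrable_pow_normal_pdf k.-1 s0.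
have i2 := integrable_pow_normal_pdf k.+1 s0.
have := normal_pdf_by_parts k s0.
move=> /(congr1 fine).
rewrite (_ : fine _ = k%:R * \int[mu]_x (x ^+ k.-1 * normal_pdf 0 s x) -
   (s ^+ 2)^-1 * \int[mu]_x (x ^+ k.+1 * normal_pdf 0 s x)).
  rewrite ss => /eqP; rewrite subr_eq0 => /eqP e.
  by rewrite (mulrC _ s2) -mulrA e mulrA mulfV ?mul1r.
rewrite -!RintegralZl// -RintegralB//.
- rewrite (_ : EFin \o _ = (fun x => k%:R%:E * (x ^+ k.-1 * normal_pdf 0 s x)%:E)%E)//.
  exact: integrableZl.
- rewrite (_ : EFin \o _ = (fun x => (s ^+ 2)^-1%:E * (x ^+ k.+1 * normal_pdf 0 s x)%:E)%E)//.
  exact: integrableZl.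
Qed.

Definition cintegrable (f : T -> R[i]) :=
  P.-integrable setT (fun w => (complex.Re (f w))%:E) /\
  P.-integrable setT (fun w => (complex.Im (f w))%:E).

Lemma complex_expectationE f : complex_expectation P f =
  Complex (\int[P]_w complex.Re (f w)) (\int[P]_w complex.Im (f w)).
Proof. by rewrite /complex_expectation /Rintegral unlock. Qed.

Lemma cintegrableD f g : cintegrable f -> cintegrable g ->
  cintegrable (fun w => f w + g w).
Proof.
move=> [f1 f2] [g1 g2]; split.
- rewrite (_ : (fun w => _) = (fun w => (complex.Re (f w))%:E + (complex.Re (g w))%:E)%E).
    exact: integrableD.
  by apply/funext => w; rewrite raddfD.
- rewrite (_ : (fun w => _) = (fun w => (complex.Im (f w))%:E + (complex.Im (g w))%:E)%E).
    exact: integrableD.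
  by apply/funext => w; rewrite raddfD.
Qed.

Lemma complex_expectationD f g : cintegrable f -> cintegrable g ->
  complex_expectation P (fun w => f w + g w) =
  complex_expectation P f + complex_expectation P g.
Proof.
move=> [f1 f2] [g1 g2]; rewrite !complex_expectationE.
transitivity (Complex
  (\int[P]_w (complex.Re (f w) + complex.Re (g w)))
  (\int[P]_w (complex.Im (f w) + complex.Im (g w)))).
  by congr Complex; apply: eq_Rintegral => w _; rewrite raddfD.
by rewrite !RintegralD.
Qed.

Lemma cintegrableZ (c : R[i]) f : cintegrable f -> cintegrable (fun w => c * f w).
Proof.
case: c => a b [f1 f2]; split.
- rewrite (_ : (fun w => _) =
    (fun w => a%:E * (complex.Re (f w))%:E - b%:E * (complex.Im (f w))%:E)%E).
    by apply: integrableB => //; exact: integrableZl.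
  by apply/funext => w; case: (f w).
- rewrite (_ : (fun w => _) =
    (fun w => a%:E * (complex.Im (f w))%:E + b%:E * (complex.Re (f w))%:E)%E).
    by apply: integrableD => //; exact: integrableZl.
  by apply/funext => w; case: (f w).
Qed.

Lemma complex_expectationZ (c : R[i]) f : cintegrable f ->
  complex_expectation P (fun w => c * f w) = c * complex_expectation P f.
Proof.
case: c => a b [f1 f2]; rewrite !complex_expectationE.
have iz (k : R) g : P.-integrable setT (fun w : T => (g w)%:E) ->
    P.-integrable setT (EFin \o (fun w => k * g w)).
  by move=> ig; rewrite (_ : EFin \o _ = (fun w => k%:E * (g w)%:E)%E)//; exact: integrableZl.
transitivity (Complex
  (\int[P]_w (a * complex.Re (f w) - b * complex.Im (f w)))
  (\int[P]_w (a * complex.Im (f w) + b * complex.Re (f w)))).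
  by congr Complex; apply: eq_Rintegral => w _; case: (f w).
rewrite RintegralB//; [|exact: iz|exact: iz].
rewrite RintegralD//; [|exact: iz|exact: iz].
by rewrite !RintegralZl.
Qed.

Lemma cintegrable_real (f : T -> R) : P.-integrable setT (fun w => (f w)%:E) ->
  cintegrable (fun w => (f w)%:C%C).
Proof. by move=> fi; split => //=; exact: finite_measure_integrable_cst. Qed.

Lemma complex_expectation_real (f : T -> R) :
  complex_expectation P (fun w => (f w)%:C%C) = (\int[P]_w f w)%:C%C.
Proof.
rewrite complex_expectationE; congr Complex.
by rewrite /Rintegral integral0.
Qed.

End GaussianMoments.

(** * Integration by parts for polynomials in independent Gaussian variables *)

Section Stein.
Context (disp : measure_display) (T : measurableType disp) (R : realType).
Variables (P : probability T R) (I : finType) (X : I -> T -> R) (s : I -> R).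
Hypothesis s0 : forall i, 0 <= s i.
Hypothesis gX : forall i, is_centered_gaussian P (X i) (s i).
Hypothesis indX : mutually_independent P X.

Let n := #|I|.
Notation pol := (mpoly n R[i]).

Definition gaussian_eval (w : T) (p : pol) : R[i] :=
  meval (fun i => (X (enum_val i) w)%:C%C) p.

Definition gaussian_expectation (p : pol) : R[i] :=
  complex_expectation P (gaussian_eval^~ p).

Let mX i : measurable_fun setT (X i). Proof. by case: (gX i). Qed.
Let M i k := \int[P]_w (X i w ^+ k).

Let iX i k : P.-integrable setT (fun w => (X i w ^+ k)%:E).
Proof. by have [+ _] := centered_gaussian_moments (s0 i) (gX i). Qed.

Let MS i k : M i k.+1 = k%:R * s i * M i k.-1.
Proof. exact: (centered_gaussian_moments (s0 i) (gX i)).2. Qed.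

Let eval_mon w (m : multinom n) :
  gaussian_eval w (mpolyX R[i] m) = (\prod_i X i w ^+ m (enum_rank i))%:C%C.
Proof.
rewrite /gaussian_eval mevalX rmorph_prod/=.
rewrite (reindex (@enum_rank I)); last by apply: onW_bij; exact: enum_rank_bij.
by apply: eq_bigr => i _; rewrite enum_rankK rmorphXn.
Qed.

Let cint_mon m : cintegrable P (gaussian_eval^~ (mpolyX R[i] m)).
Proof.
rewrite (_ : gaussian_eval^~ _ = (fun w => (\prod_i X i w ^+ m (enum_rank i))%:C%C)).
  apply: cintegrable_real.
  apply: (integrable_independent_prod mX indX (g := fun i x => x ^+ m (enum_rank i))) => //.
by apply: boolp.funext => w; exact: eval_mon.
Qed.

Lemma cintegrable_gaussian_eval p : cintegrable P (gaussian_eval^~ p).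
Proof.
elim/mpolyind: p => [|c m p _ _ IH].
  rewrite (_ : gaussian_eval^~ _ = (fun w => 0 * gaussian_eval w (mpolyX R[i] mnm0))).
    exact: cintegrableZ.
  by apply/funext => w; rewrite mul0r /gaussian_eval raddf0.
rewrite (_ : gaussian_eval^~ _ = (fun w => c * gaussian_eval w (mpolyX R[i] m)
   + gaussian_eval w p)).
  by apply: cintegrableD => //; exact: cintegrableZ.
by apply/funext => w; rewrite /gaussian_eval mevalD mevalZ.
Qed.

Lemma gaussian_expectationD p q : gaussian_expectation (p + q) =
  gaussian_expectation p + gaussian_expectation q.
Proof.
rewrite -complex_expectationD; try exact: cintegrable_gaussian_eval.
by congr complex_expectation; apply/funext => w; rewrite /gaussian_eval mevalD.
Qed.

Lemma gaussian_expectationZ c p :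
  gaussian_expectation (c *: p) = c * gaussian_expectation p.
Proof.
rewrite -complex_expectationZ; last exact: cintegrable_gaussian_eval.
by congr complex_expectation; apply/funext => w; rewrite /gaussian_eval mevalZ.
Qed.

Let E_mon m : gaussian_expectation (mpolyX R[i] m) =
  (\prod_i M i (m (enum_rank i)))%:C%C.
Proof.
rewrite /gaussian_expectation.
rewrite (_ : gaussian_eval^~ _ = (fun w => (\prod_i X i w ^+ m (enum_rank i))%:C%C)); last first.
  by apply: boolp.funext => w; exact: eval_mon.
rewrite complex_expectation_real.
rewrite (Rintegral_independent_prod mX indX (g := fun i x => x ^+ m (enum_rank i)))//.
Qed.

Lemma gaussian_expectation1 : gaussian_expectation 1 = 1.
Proof.
rewrite -mpolyX0 E_mon big1 // => i _.
rewrite /M mnm0E; under eq_Rintegral do rewrite expr0.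
rewrite Rintegral_cst// mul1r; exact: (congr1 fine (probability_setT P)).
Qed.

(** Both sides are linear in [p]. On a monomial the expectation factors by independence, and only
    the moment of variable [e] changes; there the identity is the one-dimensional moment
    recursion. *)
Lemma gaussian_expectation_by_parts (e : I) p :
  gaussian_expectation (mpolyX R[i] (mnm1 (enum_rank e)) * p) =
  (s e)%:C%C * gaussian_expectation (mderiv (enum_rank e) p).
Proof.
elim/mpolyind: p => [|c m p _ _ IH].
  by rewrite mulr0 mderiv0 -(scale0r 0) gaussian_expectationZ mul0r mulr0.
rewrite mulrDr mderivD !gaussian_expectationD IH mulrDr; congr (_ + _).
rewrite -scalerAr mderivZ !gaussian_expectationZ mulrCA; congr (_ * _).
rewrite -mpolyXD mderivX gaussian_expectationZ !E_mon.
rewrite -(rmorph_nat (real_complex R)) -!rmorphM/=; congr (_ %:C)%C.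
rewrite (bigD1 e)//= [in RHS](bigD1 e)//= !mnmDE mnmBE !mnm1E eqxx add1n MS subn1.
rewrite -!mulrA mulrCA; congr (_ * (_ * (_ * _))).
apply: eq_bigr => i ie; congr (M i _).
by rewrite mnmDE mnmBE mnm1E (inj_eq enum_rank_inj) eq_sym (negbTE ie) add0n subn0.
Qed.

End Stein.

(** * Schwinger-Dyson equations for a product of traces *)

(* The matrix Y stands for the adjoint of X, and D i j for the derivative with
   respect to the conjugate of the entry (i, j) of X. *)
Section SchwingerDyson.
Variables (K A : comNzRingType) (n : nat) (N0 N1 : {set 'I_n}).
Variables (E : {additive A -> K}) (D : 'I_n -> 'I_n -> A -> A) (nu : K).
Variables (X Y : 'M[A]_n).
Hypothesis DD : forall i j a b, D i j (a + b) = D i j a + D i j b.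
Hypothesis DM : forall i j a b, D i j (a * b) = D i j a * b + a * D i j b.
Hypothesis X0 : forall i j, ~~ ((i \in N0) && (j \in N1)) -> X i j = 0.
Hypothesis Y0 : forall i j, ~~ ((i \in N0) && (j \in N1)) -> Y j i = 0.
Hypothesis DX : forall i j k l, i \in N0 -> j \in N1 -> D i j (X k l) = 0.
Hypothesis DY : forall i j k l, i \in N0 -> j \in N1 ->
  D i j (Y l k) = ((k == i) && (l == j))%:R.
Hypothesis EX : forall i j a, i \in N0 -> j \in N1 ->
  E (X i j * a) = nu * E (D i j a).

Let D0 i j : D i j 0 = 0.
Proof. by apply: (addrI (D i j 0)); rewrite -DD !addr0. Qed.

Let D1 i j : D i j 1 = 0.
Proof.
by apply: (addrI (D i j 1)); rewrite addr0 -[in RHS](mulr1 1) DM !mulr1 mul1r.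
Qed.

Let Dsum i j (I : Type) (r : seq I) (P : pred I) F :
  D i j (\sum_(k <- r | P k) F k) = \sum_(k <- r | P k) D i j (F k).
Proof. exact: (big_morph (D i j) (DD i j) (D0 i j)). Qed.

Let DMn i j a m : D i j (a *+ m) = D i j a *+ m.
Proof. by elim: m => [|m IH]; rewrite ?mulr0n// !mulrS DD IH. Qed.

Let Dmx i j (M : 'M[A]_n) : 'M[A]_n := map_mx (D i j) M.

Let DmxM i j (M N : 'M[A]_n) : Dmx i j (M *m N) = Dmx i j M *m N + M *m Dmx i j N.
Proof.
apply/matrixP => k l; rewrite !mxE Dsum -big_split/=; apply: eq_bigr => p _.
by rewrite DM !mxE.
Qed.

Definition wishart := X *m Y.
Local Notation W := wishart.
(** For a positive exponent this is the full trace, as the rows of [W] outside [N0] vanish. The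
    restriction to [N0] matters at exponent 0, where it gives [#|N0|] instead of [n]. *)
Definition block_trace k : A := \sum_(i in N0) (W ^+ k) i i.
Local Notation T := block_trace.

Let WS k : W ^+ k.+1 = W *m W ^+ k. Proof. by rewrite exprS. Qed.
Let WD k l : W ^+ (k + l) = W ^+ k *m W ^+ l. Proof. by rewrite exprD. Qed.

Let WSr k : W ^+ k.+1 = W ^+ k *m W. Proof. by rewrite exprSr. Qed.

Let W_row k i j : i \notin N0 -> (W ^+ k.+1) i j = 0.
Proof.
move=> iN; rewrite WS -mulmxA mxE big1// => l _.
by rewrite X0 ?mul0r// (negbTE iN).
Qed.

Let YW_col k i j : i \notin N0 -> (Y *m W ^+ k) j i = 0.
Proof.
move=> iN; case: k => [|k]; first by rewrite expr0 mulmx1 Y0// (negbTE iN).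
rewrite WSr !mulmxA mxE big1// => l _.
by rewrite Y0 ?mulr0// (negbTE iN).
Qed.

Let YM_row (M : 'M[A]_n) i j : j \notin N1 -> (Y *m M) j i = 0.
Proof.
by move=> jN; rewrite mxE big1// => l _; rewrite Y0 ?mul0r// (negbTE jN) andbF.
Qed.

Let T_tr k : T k.+1 = \tr (W ^+ k.+1).
Proof.
rewrite /mxtrace (bigID (fun i => i \in N0))/= [X in _ = _ + X]big1 ?addr0//.
by move=> i iN; exact: W_row.
Qed.

Let T_XY k : T k.+1 = \sum_(i in N0) \sum_(j in N1) X i j * (Y *m W ^+ k) j i.
Proof.
apply: eq_bigr => i iN; rewrite WS -mulmxA mxE.
rewrite (bigID (fun j => j \in N1))/= [X in _ + X]big1 ?addr0//.
by move=> j jN; rewrite YM_row// mulr0.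
Qed.

Let YWX k : \sum_(j in N1) (Y *m W ^+ k *m X) j j = T k.+1.
Proof.
rewrite T_tr WSr /wishart !mulmxA -[RHS]mxtrace_mulC !mulmxA.
rewrite /mxtrace [RHS](bigID (fun j => j \in N1))/= [X in _ = _ + X]big1 ?addr0//.
by move=> j jN; rewrite -!mulmxA YM_row.
Qed.

Let DmxX i j : i \in N0 -> j \in N1 -> Dmx i j X = 0.
Proof. by move=> iN jN; apply/matrixP => k l; rewrite !mxE DX. Qed.

Let DmxY i j : i \in N0 -> j \in N1 -> Dmx i j Y = delta_mx j i.
Proof. by move=> iN jN; apply/matrixP => k l; rewrite !mxE DY// andbC. Qed.

(** Leibniz rule over the [k] factors [Y], the entries of [X] being constants for [D i j]; each [Y]
    is replaced in turn by an elementary matrix. *)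
Let DmxW i j k : i \in N0 -> j \in N1 ->
  Dmx i j (W ^+ k) = \sum_(l < k) W ^+ l *m X *m delta_mx j i *m W ^+ (k.-1 - l).
Proof.
move=> iN jN; elim: k => [|k IH].
  rewrite big_ord0 expr0; apply/matrixP => a b; rewrite !mxE.
  by rewrite DMn D1 mul0rn.
rewrite WS DmxM DmxM DmxX// mul0mx add0r DmxY// IH big_ord_recl expr0 mul1mx subn0.
rewrite mulmx_sumr; congr (_ + _); apply: eq_bigr => l _.
rewrite /lift/=/bump/= add1n WS !mulmxA; congr (_ *m W ^+ _).
by rewrite /= -subn1 -subnDA.
Qed.

Let delta_entry (M N : 'M[A]_n) i j a b :
  (M *m delta_mx j i *m N) a b = M a j * N i b.
Proof.
rewrite mxE (bigD1 i)//= mxE (bigD1 j)//= !mxE !eqxx mulr1.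
rewrite [X in (_ + X) * _]big1 ?addr0; last first.
  by move=> k kj; rewrite !mxE (negbTE kj) mulr0.
rewrite big1 ?addr0// => k ki; rewrite mxE big1 ?mul0r// => l _.
by rewrite mxE (negbTE ki) andbF mulr0.
Qed.

Let DYW i j k : i \in N0 -> j \in N1 ->
  D i j ((Y *m W ^+ k) j i) = (W ^+ k) i i +
   \sum_(l < k) (Y *m W ^+ l *m X) j j * (W ^+ (k.-1 - l)) i i.
Proof.
move=> iN jN.
have -> : D i j ((Y *m W ^+ k) j i) = (Dmx i j (Y *m W ^+ k)) j i by rewrite [RHS]mxE.
rewrite DmxM DmxY// DmxW// mulmx_sumr [LHS]mxE; congr (_ + _).
  by rewrite -(mul1mx (delta_mx j i)) delta_entry mxE eqxx mul1r.
by rewrite summxE; apply: eq_bigr => l _; rewrite !mulmxA delta_entry.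
Qed.

(** By cyclicity of the trace the [k] terms of [DmxW] coincide. *)
Let DT i j k : i \in N0 -> j \in N1 -> D i j (T k) = (W ^+ k.-1 *m X) i j *+ k.
Proof.
move=> iN jN; case: k => [|k].
  rewrite /block_trace Dsum mulr0n big1// => a _.
  by rewrite expr0 !mxE DMn D1 mul0rn.
rewrite T_tr /mxtrace Dsum.
transitivity (\tr (Dmx i j (W ^+ k.+1))).
  by apply: eq_bigr => a _; rewrite [RHS]mxE.
rewrite DmxW// raddf_sum/= -[k.+1 in RHS]card_ord -sumr_const.
apply: eq_bigr => l _; rewrite mxtrace_mulC !mulmxA -WD subnK; last by rewrite -ltnS.
rewrite /mxtrace (bigD1 i)//= big1 ?addr0.
  by rewrite -[_ *m delta_mx _ _]mulmx1 delta_entry [X in _ * X]mxE eqxx mulr1.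
move=> a ai; rewrite -[_ *m delta_mx _ _]mulmx1 delta_entry [X in _ * X]mxE.
by rewrite eq_sym (negbTE ai) mulr0.
Qed.

Definition trace_product (s : seq nat) : A := \prod_(l <- s) T l.
Local Notation G := trace_product.
Definition trace_moment (s : seq nat) : K := E (G s).

Definition delete_nth (s : seq nat) p := take p s ++ drop p.+1 s.

Let DG i j s : D i j (G s) =
  \sum_(p < size s) D i j (T (nth 0%N s p)) * G (delete_nth s p).
Proof.
rewrite /trace_product; elim: s => [|a s IH]; first by rewrite big_nil D1 big_ord0.
rewrite big_cons DM IH /= big_ord_recl/= /delete_nth/= drop0; congr (_ + _).
rewrite big_distrr/=; apply: eq_bigr => p _.
by rewrite /bump/= add1n/= add0n big_cons mulrCA.
Qed.

Lemma trace_moment_nil : trace_moment [::] = E 1.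
Proof. by rewrite /trace_moment /trace_product big_nil. Qed.

Lemma trace_moment0 s : trace_moment (0%N :: s) = trace_moment s *+ #|N0|.
Proof.
rewrite /trace_moment /trace_product big_cons -raddfMn/= -mulr_natl; congr (E (_ * _)).
rewrite /block_trace expr0 (eq_bigr (fun=> 1)) ?sumr_const// => i _.
by rewrite mxE eqxx.
Qed.

(** Write the leading trace as a sum of X_ij (Y W^k)_ji and integrate by parts in X_ij. The
    derivative of the first [Y] gives the term with [#|N1|]; a derivative inside W^k cuts the trace
    in two; a derivative of another trace glues it to the leading one, once for each of its factors
    [Y]. *)
Lemma schwinger_dyson k s :
  trace_moment (k.+1 :: s) = nu *
   (trace_moment (k :: s) *+ #|N1|
    + \sum_(l < k) trace_moment [:: l.+1, (k.-1 - l)%N & s]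
    + \sum_(p < size s) trace_moment ((k + nth 0%N s p)%N :: delete_nth s p)
        *+ nth 0%N s p).
Proof.
rewrite /trace_moment {1}/trace_product big_cons -/(G s) T_XY mulr_suml raddf_sum/=.
transitivity (nu * E (\sum_(i in N0) \sum_(j in N1) D i j ((Y *m W ^+ k) j i * G s))).
  rewrite raddf_sum/= mulr_sumr; apply: eq_bigr => i iN.
  rewrite mulr_suml !raddf_sum/= mulr_sumr; apply: eq_bigr => j jN.
  by rewrite -mulrA EX.
congr (_ * _).
rewrite -raddfMn/= -raddf_sum/= -raddfD/=.
rewrite [X in _ = _ + X](eq_bigr (fun p : 'I_(size s) =>
    E (G ((k + nth 0%N s p)%N :: delete_nth s p) *+ nth 0%N s p))); last first.
  by move=> p _; rewrite raddfMn.
rewrite -raddf_sum/= -raddfD/=; congr (E _).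
transitivity (\sum_(i in N0) \sum_(j in N1)
  ((W ^+ k) i i * G s
   + \sum_(l < k) (Y *m W ^+ l *m X) j j * (W ^+ (k.-1 - l)) i i * G s
   + \sum_(p < size s) ((Y *m W ^+ k) j i * (W ^+ (nth 0%N s p).-1 *m X) i j)
         *+ nth 0%N s p * G (delete_nth s p))).
  apply: eq_bigr => i iN; apply: eq_bigr => j jN.
  rewrite DM DYW// mulrDl mulr_suml; congr (_ + _).
  rewrite DG mulr_sumr; apply: eq_bigr => p _.
  by rewrite DT// mulrA mulrnAr.
transitivity (\sum_(i in N0) \sum_(j in N1) (W ^+ k) i i * G s
   + \sum_(i in N0) \sum_(j in N1)
       \sum_(l < k) (Y *m W ^+ l *m X) j j * (W ^+ (k.-1 - l)) i i * G s
   + \sum_(i in N0) \sum_(j in N1)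
       \sum_(p < size s) ((Y *m W ^+ k) j i * (W ^+ (nth 0%N s p).-1 *m X) i j)
         *+ nth 0%N s p * G (delete_nth s p)).
  by rewrite -!big_split; apply: eq_bigr => i _; rewrite -!big_split.
congr (_ + _ + _).
- rewrite (eq_bigr (fun i => (W ^+ k) i i * G s *+ #|N1|)); last first.
    by move=> i _; rewrite sumr_const.
  by rewrite sumrMnl -mulr_suml {2}/trace_product big_cons.
- rewrite (eq_bigr (fun i => \sum_(l < k) \sum_(j in N1)
    (Y *m W ^+ l *m X) j j * (W ^+ (k.-1 - l)) i i * G s)); last first.
    by move=> i _; exact: exchange_big.
  rewrite exchange_big/=; apply: eq_bigr => l _.
  rewrite /trace_product !big_cons -/(G s) -YWX /block_trace mulrA big_distrlr/=.
  rewrite exchange_big/= mulr_suml; apply: eq_bigr => i iN.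
  by rewrite mulr_suml.
- rewrite (eq_bigr (fun i => \sum_(p < size s) \sum_(j in N1)
    ((Y *m W ^+ k) j i * (W ^+ (nth 0%N s p).-1 *m X) i j)
         *+ nth 0%N s p * G (delete_nth s p))); last first.
    by move=> i _; exact: exchange_big.
  rewrite exchange_big/=; apply: eq_bigr => p _.
  rewrite [in RHS]/trace_product big_cons -mulrnAl -/(G _).
  (* A trace of exponent 0 is constant: its multiplicity 0 removes the term in which [.-1] would be
     meaningless. Otherwise the sum over [i] and [j] closes up into one trace of exponent k + m +
     1. *)
  move: (G (delete_nth s p)) (nth 0%N s p) => g [|m].
    rewrite [RHS]mul0r big1// => i _; rewrite big1// => j _.
    exact: mul0r.
  rewrite (eq_bigr (fun i => (\sum_(j in N1)
    (Y *m W ^+ k) j i * (W ^+ m *m X) i j) *+ m.+1 * g)); last first.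
    by move=> i _; rewrite -mulr_suml sumrMnl.
  rewrite -mulr_suml sumrMnl; congr (_ *+ _ * _).
  rewrite addnS -YWX exchange_big/=; apply: eq_bigr => j jN.
  rewrite WD !mulmxA -[in RHS]mulmxA [RHS]mxE.
  rewrite [RHS](bigID (fun i => i \in N0))/= [X in _ = _ + X]big1 ?addr0//.
  by move=> i iN; rewrite YW_col// mul0r.
Qed.

End SchwingerDyson.

(** * Narayana polynomials *)

Section Narayana.
Variable R : realType.

(** At k = 0 the coefficient of [f 0] vanishes. Hence [f 1] determines all later values and [f 0]
    stays free, so sequences that differ at 0 can be compared. *)
Definition three_term (t : R) (f : nat -> R) : Prop := forall k : nat,
  k.+3%:R * f k.+2 =
  k.*2.+3%:R * (1 + t) * f k.+1 - k%:R * (1 - t) ^+ 2 * f k.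

Lemma three_term_unique t f g : three_term t f -> three_term t g ->
  f 1%N = g 1%N -> forall k, f k.+1 = g k.+1.
Proof.
move=> hf hg fg1; elim/ltn_ind => -[//|[|k]] IH.
- apply: (@mulfI _ 3%:R); first by rewrite pnatr_eq0.
  by have := hf 0%N; have := hg 0%N; rewrite !mul0r !subr0 => -> ->; rewrite fg1.
- apply: (@mulfI _ k.+4%:R); first by rewrite pnatr_eq0.
  by have := hf k.+1; have := hg k.+1 => -> ->; rewrite !IH//.
Qed.

Let b (k j : nat) : R := narayana_number R k j.+1.

(** Denominators are cleared in a form symmetric in [p] and [q], so that neighbouring Narayana
    numbers differ by explicit polynomial factors in [p] and [q]. *)
Lemma narayana_numberE p q :
  narayana_number R (p + q).+1 p.+1 * (p`! * p.+1`! * q`! * q.+1`!)%:R =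
  ((p + q)`! * (p + q).+1`!)%:R.
Proof.
rewrite /narayana_number /=.
have h1 := bin_fact (leq_addr q p); rewrite addKn in h1.
have h2 := bin_fact (leqW (leq_addr q p)).
rewrite subSn ?leq_addr// addKn in h2.
rewrite -[in RHS]h1 -[in RHS]h2 (factS p).
rewrite !natrM; field.
by rewrite addrC natr1 pnatr_eq0.
Qed.

Lemma narayana_number0 k j : (k < j)%N -> narayana_number R k.+1 j.+1 = 0.
Proof. by move=> kj; rewrite /narayana_number/= bin_small// mulr0 mul0r. Qed.

(* After multiplication by p! (p+1)! q! (q+1)!, the factors q (q + 1), ...
   produced by the shifted terms vanish at the boundary. *)
Lemma narayana_number_rec p q k : (p + q = k.+2)%N ->
  k.+4%:R * b k.+3 p =
  k.+1.*2.+3%:R * (b k.+2 p + (if p is p'.+1 then b k.+2 p' else 0))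
  - k.+1%:R * (b k.+1 p - (if p is p'.+1 then 2 * b k.+1 p' else 0)
     + (if p is p'.+2 then b k.+1 p' else 0)).
Proof.
move=> pq; pose D : R := (p`! * p.+1`! * q`! * q.+1`!)%:R.
have D0 : D != 0 by rewrite pnatr_eq0 -lt0n !muln_gt0 !fact_gt0.
pose f : R := (k`! * k.+1`!)%:R.
have e0 : b k.+3 p * D = f * (k.+1%:R * k.+2%:R ^+ 2 * k.+3%:R).
  by rewrite /b -pq narayana_numberE pq !factS !natrM /f !factS !natrM; ring.
have e1 : b k.+2 p * D = f * k.+1%:R * k.+2%:R * (q%:R * (q%:R + 1)).
  case: q pq @D D0 {e0} => [|q] pq D D0.
    by rewrite /b narayana_number0 ?mul0r//; [rewrite mulr0|lia].
  have {}pq : (p + q = k.+1)%N by lia.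
  rewrite /b -pq /D (_ : (_ * _ * _ * _)%N =
     (p`! * p.+1`! * q`! * q.+1`! * (q.+1 * q.+2))%N); last by rewrite !factS; ring.
  rewrite natrM mulrA narayana_numberE pq /f !factS !natrM natr1; ring.
have e2 : (if p is p'.+1 then b k.+2 p' else 0) * D =
     f * k.+1%:R * k.+2%:R * (p%:R * (p%:R + 1)).
  case: p pq @D D0 {e0 e1} => [|p] pq D D0; first by ring.
  have {}pq : (p + q = k.+1)%N by lia.
  rewrite /b -pq /D (_ : (_ * _ * _ * _)%N =
     (p`! * p.+1`! * q`! * q.+1`! * (p.+1 * p.+2))%N); last by rewrite !factS; ring.
  rewrite natrM mulrA narayana_numberE pq /f !factS !natrM natr1; ring.
have e3 : b k.+1 p * D = f * ((q%:R - 1) * q%:R ^+ 2 * (q%:R + 1)).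
  case: q pq @D D0 {e0 e1 e2} => [|[|q]] pq D D0.
  - by rewrite /b narayana_number0 ?mul0r//; [ring|lia].
  - by rewrite /b narayana_number0 ?mul0r//; [ring|lia].
  have {}pq : (p + q = k)%N by lia.
  rewrite /b -pq /D (_ : (_ * _ * _ * _)%N =
     (p`! * p.+1`! * q`! * q.+1`! * (q.+1 * q.+2 * (q.+2 * q.+3)))%N); last by rewrite !factS; ring.
  by rewrite natrM mulrA narayana_numberE pq /f !natrM natr1 -!(natr1 q.+1) -!(natr1 q); ring.
have e4 : (if p is p'.+1 then 2 * b k.+1 p' else 0) * D =
     f * (2 * (p%:R * (p%:R + 1) * (q%:R * (q%:R + 1)))).
  case: q pq @D D0 {e0 e1 e2 e3} => [|q] pq D D0.
    case: p pq @D D0 => [|p] pq D D0; first by ring.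
    by rewrite /b narayana_number0 ?mul0r//; [ring|lia].
  case: p pq @D D0 => [|p] pq D D0; first by ring.
  have {}pq : (p + q = k)%N by lia.
  rewrite /b -pq /D (_ : (_ * _ * _ * _)%N =
     (p`! * p.+1`! * q`! * q.+1`! * (q.+1 * q.+2 * (p.+1 * p.+2)))%N); last by rewrite !factS; ring.
  by rewrite natrM -mulrA (mulrA (narayana_number _ _ _)) narayana_numberE pq /f !natrM !natr1; ring.
have e5 : (if p is p'.+2 then b k.+1 p' else 0) * D =
     f * ((p%:R - 1) * p%:R ^+ 2 * (p%:R + 1)).
  case: p pq @D D0 {e0 e1 e2 e3 e4} => [|[|p]] pq D D0; first by ring.
    by ring.
  have {}pq : (p + q = k)%N by lia.
  rewrite /b -pq /D (_ : (_ * _ * _ * _)%N =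
     (p`! * p.+1`! * q`! * q.+1`! * (p.+1 * p.+2 * (p.+2 * p.+3)))%N); last by rewrite !factS; ring.
  by rewrite natrM mulrA narayana_numberE pq /f !natrM natr1 -!(natr1 p.+1) -!(natr1 p); ring.
apply: (mulIf D0).
have -> (x y z u v w X c : R) : (X * (x + y) - c * (z - u + v)) * w =
   X * (x * w + y * w) - c * (z * w - u * w + v * w) by ring.
rewrite -mulrA e0 e1 e2 e3 e4 e5.
have -> : q%:R = k%:R + 2 - p%:R :> R.
  by apply/eqP; rewrite eq_sym subr_eq -!natrD (addnC q) pq addn2.
rewrite (_ : k.+1.*2.+3 = 2 * k + 5)%N; last by lia.
rewrite natrD natrM -!(natr1 k.+3) -!(natr1 k.+2) -!(natr1 k.+1) -!(natr1 k); ring.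
Qed.

Lemma narayana_poly_three_term (t : R) : three_term t (fun k => narayana_poly k t).
Proof.
(* A factor [t] is split off, so that coefficient j of [P k] is N(k, j + 1); for k > 0 the
   recurrence becomes an identity of polynomials, checked on coefficients. *)
pose P k : {poly R} := \poly_(j < k) b k j.
have NP k : narayana_poly k t = t * (P k).[t].
  rewrite /narayana_poly horner_poly big_add1/= big_mkord big_distrr/=.
  by apply: eq_bigr => i _; rewrite exprS mulrCA.
have bP k j : (P k.+1)`_j = b k.+1 j.
  by rewrite coef_poly; case: ltnP => // kj; rewrite /b narayana_number0.
case=> [|k].
  rewrite /narayana_poly !big_add1/= !big_mkord !big_ord_recl !big_ord0.
  by rewrite /narayana_number/=/bump/= ?bin0 ?binn ?bin1 addn0 double0; field.
rewrite !NP.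
have : k.+4%:R *: P k.+3 = k.+1.*2.+3%:R *: (P k.+2 + P k.+2 * 'X)
   - k.+1%:R *: (P k.+1 - 2%:R *: (P k.+1 * 'X) + P k.+1 * 'X * 'X).
  apply/polyP => j; rewrite !(coefZ, coefD, coefB, coefMX, coefN, bP).
  have [jk|kj] := leqP j k.+2.
    have /narayana_number_rec -> : (j + (k.+2 - j) = k.+2)%N by lia.
    by case: j {jk} => [|[|j]] /=; rewrite ?(mulr0, coefMX, bP) ?mulr0.
  case: j kj => [|[|[|j]]]//= jk.
  rewrite /b !narayana_number0 ?(mulr0, addr0, subr0)//; lia.
move=> /(congr1 (fun p => p.[t])).
rewrite !(hornerZ, hornerD, hornerN, hornerMX) => e.
rewrite mulrCA e; ring.
Qed.

(* Let H be the generating function of h, so that H = 1 + z((t - 1) H + H^2).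
   Then D = 1 - (t - 1) z - 2 z H satisfies D^2 = Del for a quadratic
   polynomial Del, hence 2 Del D' = Del' D, whose coefficients are the claim.
   In the proof H is truncated at a high order. *)
Lemma quadratic_three_term (t : R) (h : nat -> R) : h 0%N = 1 ->
  (forall k, h k.+1 = t * h k + \sum_(l < k) h l.+1 * h (k.-1 - l)%N) ->
  three_term t h.
Proof.
move=> h0 hS k; pose M := k.+4.
pose H : {poly R} := \poly_(i < M) h i.
pose s := t - 1.
pose E : {poly R} := H - 1 - 'X * (s *: H + H ^+ 2).
have EM j : (j < M)%N -> E`_j = 0.
  move=> jM; rewrite /E !(coefN, coefXM, coefD, coefZ) coef1.
  case: j jM => [|j] jM.
    by rewrite coef_poly/= h0 subrr subr0.
  rewrite /= subr0 coef_poly jM coef_poly ltnW// hS expr2 coefM.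
  rewrite big_ord_recl subn0 !coef_poly (ltnW jM)/= h0 mul1r.
  have -> : \sum_(i < j) H`_(lift ord0 i) * H`_(j - lift ord0 i) =
            \sum_(l < j) h l.+1 * h (j.-1 - l)%N.
    apply: eq_bigr => i _; rewrite /lift/=/bump/= add1n !coef_poly.
    rewrite !ifT; last 2 first.
    - by have := ltn_ord i; lia.
    - by have := ltn_ord i; lia.
    by congr (_ * h _); have := ltn_ord i; lia.
  rewrite /s; ring.
pose D : {poly R} := 1 - s *: 'X - 2%:R *: ('X * H).
pose Del : {poly R} := (1 - s *: 'X) ^+ 2 - 4%:R *: 'X.
have DD : D ^+ 2 - Del = - 4%:R *: 'X * E.
  by rewrite /D /Del /E -!mul_polyC; ring.
(* The exact identity for the truncated series: each term on the right contains [E] or its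
   derivative, and so has no coefficient at index k + 2. *)
have HD : 2%:R *: (Del * D^`()) - Del^`() * D =
     ((- 4%:R *: 'X * E)^`()) * D + (8%:R *: 'X * E) * D^`().
  have -> : 8%:R *: 'X * E = - 2%:R *: (- 4%:R *: 'X * E).
    by rewrite -!scalerAl scalerA; congr (_ *: _); ring.
  have dDD : (D ^+ 2 - Del)^`() = D^`() * D + D * D^`() - Del^`().
    by rewrite [LHS]derivB expr2 [X in X - _]derivM.
  rewrite -DD dDD -!mul_polyC; ring.
have EM' j : (j < k.+3)%N -> E^`()`_j = 0.
  by move=> jM; rewrite coef_deriv EM// mul0rn.
have /(congr1 (fun p : {poly R} => p`_k.+2)) := HD.
rewrite [RHS]coefD.
have -> : ((- 4%:R *: 'X * E)^`() * D)`_k.+2 = 0.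
  rewrite coefM big1// => i _; rewrite -scalerAl derivZ coefZ derivM coefD derivX mul1r coefXM.
  have ik : (i < k.+3)%N by [].
  rewrite EM; last by rewrite /M; lia.
  by case: ifP => _; rewrite ?EM' ?addr0 ?mulr0 ?mul0r//; lia.
have -> : (8%:R *: 'X * E * D^`())`_k.+2 = 0.
  rewrite coefM big1// => i _; rewrite -scalerAl coefZ coefXM.
  have ik : (i < k.+3)%N by [].
  case: ifP => _; rewrite ?EM ?mulr0 ?mul0r//; rewrite /M; lia.
have DelE : Del = 1 - (2 * (t + 1)) *: 'X + ((t - 1) ^+ 2) *: ('X * 'X).
  by rewrite /Del /s -!mul_polyC !polyCM !(polyCD, polyCN) !polyC1; ring.
have Del'E : Del^`() = - (2 * (t + 1))%:P + ((t - 1) ^+ 2 * 2) *: 'X.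
  rewrite DelE -polyC1 !(derivD, derivN, derivZ, derivM, derivX, derivC).
  have -> : 2 * (t + 1) = t * 2%:R + 2%:R by ring.
  rewrite -!mul_polyC !(polyCM, polyCD) !(polyCN, polyC1); ring.
rewrite Del'E DelE.
have Dj j : (j < k.+4)%N -> (0 < j)%N -> D`_j.+1 = - 2%:R * h j.
  move=> jk j0; rewrite /D !(coefN, coefD, coefZ, coefXM, coef1, coefX)/=.
  by rewrite coef_poly jk eqSS (gtn_eqF j0) mulr0; ring.
clearbody D; clear DD HD DelE Del'E Del EM EM' E H.
have -> : (2%:R *: ((1 - (2 * (t + 1)) *: 'X + (t - 1) ^+ 2 *: ('X * 'X)) * D^`())
   - (- (2 * (t + 1))%:P + ((t - 1) ^+ 2 * 2) *: 'X) * D) =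
   2%:R *: D^`() - (4%:R * (t + 1)) *: ('X * D^`())
    + (2%:R * (t - 1) ^+ 2) *: ('X * ('X * D^`()))
    + (2 * (t + 1)) *: D - ((t - 1) ^+ 2 * 2) *: ('X * D).
  rewrite -!mul_polyC !rmorphM/=; ring.
have [k2 k1] : (k.+2 < k.+4 /\ k.+1 < k.+4)%N by rewrite !ltnS; lia.
rewrite !(coefN, coefD, coefZ, coefXM)/= !coef_deriv (Dj k.+2 k2 isT) (Dj k.+1 k1 isT).
rewrite -(mulr_natr _ k.+3) -(mulr_natr _ k.+2) -(mulr_natr _ k.+1).
have -> : k.*2.+3%:R = 2 * k%:R + 3 :> R by rewrite -natrM -natrD; congr _%:R; lia.
rewrite -!(natr1 k.+2) -!(natr1 k.+1) -!(natr1 k).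
(* The coefficient identity that was read off is -4 times the claimed recurrence. *)
have lin (a a' c c' q : R) : a = a' -> c - c' = q * (a - a') -> c = c'.
  by move=> -> /eqP; rewrite subrr mulr0 subr_eq0 => /eqP.
(* Coefficient 1 of [D] also contains -(t - 1), so [Dj] excludes it; for k = 0 it occurs with total
   factor 0. *)
have [->|k0] := posnP k.
  by move=> e; apply: (lin _ _ _ _ (- 4^-1) e); field.
have kk : (k < k.+4)%N by rewrite !ltnS; lia.
rewrite (Dj k kk k0) => e.
apply: (lin _ _ _ _ (- 4^-1) e).
by field.
Qed.

End Narayana.

(** * Limits of the trace moments *)

Section Limit.
Variables (K : numFieldType) (r a b : nat -> K^o) (m : nat -> seq nat -> K^o).
Variables (ca cb : K^o) (mu : nat -> K^o).
Hypothesis cr : r @ \oo --> (0 : K^o).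
Hypothesis cva : a @ \oo --> ca.
Hypothesis cvb : b @ \oo --> cb.
Hypothesis m_nil : \forall n \near \oo, m n [::] = 1.
Hypothesis m0 : forall s, \forall n \near \oo, m n (0%N :: s) = a n * m n s.
Hypothesis mS : forall k s, \forall n \near \oo, m n (k.+1 :: s) =
  b n * m n (k :: s) + \sum_(l < k) m n [:: l.+1, (k.-1 - l)%N & s]
  + r n * \sum_(p < size s) m n ((k + nth 0%N s p)%N :: delete_nth s p)
       *+ nth 0%N s p.
Hypothesis mu0 : mu 0%N = ca.
Hypothesis muS : forall k, mu k.+1 = cb * mu k +
  \sum_(l < k) mu l.+1 * mu (k.-1 - l)%N.

Let cvg_sum (I : finType) (f : I -> nat -> K^o) (l : I -> K^o) :
  (forall i, f i @ \oo --> l i) ->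
  (fun n => \sum_i f i n) @ \oo --> \sum_i l i.
Proof.
move=> fl; elim: (index_enum I) => [|i s IH].
  by rewrite big_nil; under eq_fun do rewrite big_nil; exact: cvg_cst.
rewrite big_cons; under eq_fun do rewrite big_cons.
exact: cvgD.
Qed.

Let sumn_delete s p : (p < size s)%N ->
  (sumn (delete_nth s p) + nth 0%N s p = sumn s)%N.
Proof.
move=> ps; rewrite -[in RHS](cat_take_drop p s) (drop_nth 0%N ps) /delete_nth.
by rewrite !sumn_cat/=; lia.
Qed.

Let size_delete (s : seq nat) p : (p < size s)%N -> (size (delete_nth s p)).+1 = size s.
Proof. by move=> ps; rewrite size_cat size_take size_drop ps; lia. Qed.

(* Every term of the recursion decreases 2 * (total degree) + (number of
   traces); the terms with the factor r vanish in the limit. *)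
Lemma cvg_normalized_moment s : m^~ s @ \oo --> \prod_(l <- s) mu l.
Proof.
have [N] := ubnP ((sumn s).*2 + size s)%N; elim: N s => // N IH [|[|k] s] /=.
- by move=> _; rewrite big_nil; apply: cvg_near_cst; exact: m_nil.
- move=> sN; rewrite big_cons mu0.
  apply: (@cvg_trans _ ((fun n => a n * m n s : K^o) @ \oo)).
    by apply: near_eq_cvg; apply: filterS (m0 s) => n ->.
  by apply: cvgM => //; apply: IH; lia.
move=> sN; rewrite big_cons muS.
(* The gluing terms are added with the factor 0 = lim r, so that the limit matches the recursion
   summand by summand. *)
have -> : (cb * mu k + \sum_(l < k) mu l.+1 * mu (k.-1 - l)%N) * \prod_(j <- s) mu j =
  cb * \prod_(j <- k :: s) mu j +
   \sum_(l < k) \prod_(j <- [:: l.+1, (k.-1 - l)%N & s]) mu j +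
  0 * \sum_(p < size s) (\prod_(j <- (k + nth 0%N s p)%N :: delete_nth s p) mu j
       *+ nth 0%N s p).
  rewrite mul0r addr0 big_cons mulrDl mulrA mulr_suml; congr (_ + _).
  by apply: eq_bigr => l _; rewrite !big_cons mulrA.
apply: (@cvg_trans _ ((fun n => b n * m n (k :: s)
  + \sum_(l < k) m n [:: l.+1, (k.-1 - l)%N & s]
  + r n * \sum_(p < size s) m n ((k + nth 0%N s p)%N :: delete_nth s p)
       *+ nth 0%N s p : K^o) @ \oo)).
  by apply: near_eq_cvg; apply: filterS (mS k s) => n ->.
apply: cvgD; [apply: cvgD|].
- by apply: cvgM => //; apply: IH => /=; lia.
- by apply: cvg_sum => l; apply: IH => /=; have := ltn_ord l; lia.
- apply: cvgM => //; apply: cvg_sum => p; apply: cvgMn; apply: IH => /=.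
  by have := sumn_delete (ltn_ord p); have := size_delete (ltn_ord p); lia.
Qed.

End Limit.

(** * The quadratic recursion of the Narayana polynomials *)

Section QuadraticNarayana.
Variables (R : realType) (t : R).

(** The recursion refers to all earlier values, so the list of the first k + 1 values is built by
    structural recursion. *)
Fixpoint quadratic_seq (k : nat) : seq R :=
  if k is k'.+1 then
    let s := quadratic_seq k' in
    rcons s (t * s`_k' + \sum_(l < k') s`_l.+1 * s`_(k'.-1 - l))
  else [:: 1].

Let h k := (quadratic_seq k)`_k.

Let size_quadratic k : size (quadratic_seq k) = k.+1.
Proof. by elim: k => //= k IH; rewrite size_rcons IH. Qed.

Let quadratic_nth k i : (i <= k)%N -> (quadratic_seq k)`_i = h i.
Proof.
elim: k => [|k IH]; first by case: i.
rewrite leq_eqVlt => /predU1P[->//|ik].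
by rewrite /= nth_rcons size_quadratic ik IH.
Qed.

Let hS k : h k.+1 = t * h k + \sum_(l < k) h l.+1 * h (k.-1 - l)%N.
Proof.
rewrite {1}/h /= nth_rcons size_quadratic ltnn eqxx quadratic_nth//; congr (_ + _).
apply: eq_bigr => l _; have := ltn_ord l => lk.
by rewrite !quadratic_nth//; lia.
Qed.

Let hN k : h k.+1 = narayana_poly k.+1 t.
Proof.
apply: (@three_term_unique _ t h (fun k => narayana_poly k t)).
- exact: quadratic_three_term.
- exact: narayana_poly_three_term.
- rewrite hS big_ord0 addr0 /h/= mulr1 /narayana_poly big_nat1 /narayana_number.
  by rewrite bin0 bin0 !mulr1 invr1 mul1r expr1.
Qed.

(** As an empty sum [narayana_poly 0 t] is 0, whereas the convolution and the mass of a probability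
    need the value 1. *)
Definition narayana0 k : R := if k is 0%N then 1 else narayana_poly k t.

(** No convolution of Narayana numbers is computed: the solution of the quadratic recursion obeys
    the three-term recurrence with the same first value, and so it is the Narayana sequence. *)
Lemma narayana_quadratic k : narayana_poly k.+1 t =
  t * narayana0 k + \sum_(l < k) narayana0 l.+1 * narayana0 (k.-1 - l).
Proof.
have n0 j : narayana0 j = h j by case: j => [|j] //=; rewrite hN.
by rewrite -hN hS n0; congr (_ + _); apply: eq_bigr => l _; rewrite !n0.
Qed.

End QuadraticNarayana.

(** * The block Gaussian matrix *)

Section CornerPower.
Variables (R : realType) (n : nat) (N0 N1 : {set 'I_n}) (M : 'M[R[i]]_n).
Hypothesis N01 : [disjoint N0 & N1]%B.

Let p := block_proj R N0.
Let q := block_proj R N1.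
Let B := p *m M *m q + q *m M *m p.
Let A := p *m M *m q.

Let proj_idem (S : {set 'I_n}) : block_proj R S *m block_proj R S = block_proj R S.
Proof.
rewrite mulmx_diag; congr diag_mx; apply/rowP => j; rewrite !mxE.
by case: (j \in S); rewrite ?mulr1 ?mulr0.
Qed.

Let proj_disj (S S' : {set 'I_n}) : [disjoint S & S']%B ->
  block_proj R S *m block_proj R S' = 0.
Proof.
move=> SS; rewrite mulmx_diag -(raddf0 (@diag_mx _ n)); congr diag_mx.
apply/rowP => j; rewrite !mxE; have [jS|] := boolP (j \in S); last by rewrite mul0r.
by rewrite (disjointFr SS jS) mulr0.
Qed.

Let proj_adj (S : {set 'I_n}) : adjoint (block_proj R S) = block_proj R S.
Proof.
apply/matrixP => i j; rewrite !mxE eq_sym; case: eqP => [->|_].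
  by rewrite !mulr1n rmorph_nat.
by rewrite !mulr0n rmorph0.
Qed.

Let adjM (C D : 'M[R[i]]_n) : adjoint (C *m D) = adjoint D *m adjoint C.
Proof. by rewrite /adjoint trmx_mul map_mxM. Qed.

Let adjD (C D : 'M[R[i]]_n) : adjoint (C + D) = adjoint C + adjoint D.
Proof. by rewrite /adjoint linearD map_mxD. Qed.

Lemma corner_power k j : j \in N0 ->
  ((B *m adjoint B) ^+ k) j j = ((A *m adjoint A) ^+ k) j j.
Proof.
move=> jN.
have pq : p *m q = 0 by exact: proj_disj.
have qp : q *m p = 0 by apply: proj_disj; rewrite disjoint_sym.
have pB : p *m (B *m adjoint B) = A *m adjoint A.
  rewrite mulmxA /B mulmxDr !mulmxA proj_idem pq !mul0mx addr0 -/A.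
  rewrite adjD mulmxDr [X in _ + X](_ : _ = 0) ?addr0//.
  by rewrite !adjM !proj_adj /A -!mulmxA (mulmxA q p) qp !mul0mx !mulmx0.
have Wp : (A *m adjoint A) *m p = A *m adjoint A.
  by rewrite -mulmxA /A !adjM !proj_adj -!mulmxA proj_idem.
have key : p *m (B *m adjoint B) ^+ k = (A *m adjoint A) ^+ k *m p.
  elim: k => [|k IH]; first by rewrite !expr0 mulmx1 mul1mx.
  by rewrite !exprSr -!mulmxE mulmxA IH -mulmxA pB -[in RHS]mulmxA Wp.
have := congr1 (fun C : 'M[R[i]]_n => C j j) key.
by rewrite mul_diag_mx mul_mx_diag !mxE jN mul1r mulr1.
Qed.

End CornerPower.

Section BlockGaussian.
Context (disp : measure_display) (T : measurableType disp) (R : realType).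
Variables (P : probability T R) (n : nat) (N : 'I_2 -> {set 'I_n}) (v : 'M[R]_2).
Variable Y : T -> 'M[R[i]]_n.
Hypothesis n0 : (0 < n)%N.
Hypothesis HN : is_interval_partition N.
Hypothesis v0 : forall a b, 0 <= v a b.
Hypothesis v01 : v 0 1 = 1.
Hypothesis HY : is_block_gaussian P N v Y.

Let I := (bool * ('I_n * 'I_n))%type.
Let label (i : 'I_n) : 'I_2 := if i \in N 0 then 0 else 1.
Let s (e : I) : R := v (label e.2.1) (label e.2.2) / (2 * n%:R).

Let N01 : [disjoint N 0 & N 1]%B.
Proof. by case: HN => _ _ + _; rewrite -setI_eq0 => ->. Qed.

Let label_in i : i \in N (label i).
Proof.
rewrite /label; case: ifPn => // iN; case: HN => _ _ _ /setP/(_ i).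
by rewrite !finset.inE (negbTE iN).
Qed.

Let s0 e : 0 <= s e.
Proof. by rewrite divr_ge0// mulr_ge0. Qed.

Let gY e : is_centered_gaussian P (part_of_entry Y e) (s e).
Proof. by case: e => im [i j]; case: HY => _; apply. Qed.

Let indY : mutually_independent P (part_of_entry Y). Proof. by case: HY. Qed.

Let sE im i j : i \in N 0 -> j \in N 1 -> s (im, (i, j)) = (2 * n%:R)^-1.
Proof.
move=> iN jN; rewrite /s /label/= iN.
by rewrite (disjointFl N01 jN) v01 mul1r.
Qed.

Notation pol := (mpoly #|{: I}| R[i]).
Let var (e : I) : pol := mpolyX R[i] (mnm1 (enum_rank e)).
Let im : R[i] := Complex 0 1.
Let E := gaussian_expectation P (part_of_entry Y).

Let imim : im * im = -1.
Proof. by apply/eqP; rewrite eq_complex/= !mul0r !mulr1 mulr0 sub0r addr0 oppr0 !eqxx. Qed.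

(** The formal variables are the real and imaginary parts, so conjugation is a change of sign and
    [Z] is the formal adjoint of [X]. *)
Let X : 'M[pol]_n := \matrix_(i, j) if (i \in N 0) && (j \in N 1) then
  var (false, (i, j)) + im *: var (true, (i, j)) else 0.
Let Z : 'M[pol]_n := \matrix_(j, i) if (i \in N 0) && (j \in N 1) then
  var (false, (i, j)) - im *: var (true, (i, j)) else 0.

(* The Wirtinger derivative along the conjugate of the entry (i, j). *)
Let D i j (p : pol) : pol := 2^-1 *: (mderiv (enum_rank (false, (i, j)) : 'I_#|{: I}|) p
  + im *: mderiv (enum_rank (true, (i, j)) : 'I_#|{: I}|) p).

Let mderiv_var e f : mderiv (enum_rank f : 'I_#|{: I}|) (var e) = (e == f)%:R.
Proof.
rewrite mderivX mnm1E (inj_eq enum_rank_inj); case: eqP => [->|_]; last by rewrite scale0r.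
rewrite scale1r -mpolyX0; congr mpolyX; apply/mnmP => a.
by rewrite mnmBE mnm0E subnn.
Qed.

Let DXe i j k l : i \in N 0 -> j \in N 1 -> D i j (X k l) = 0.
Proof.
move=> iN jN; rewrite mxE /D; case: ifP => _; last by rewrite !mderiv0 scaler0 addr0 scaler0.
rewrite !mderivD !mderivZ !mderiv_var !xpair_eqE/= scaler0 addr0 add0r scalerA imim.
by rewrite scaleN1r subrr scaler0.
Qed.

Let DZe i j k l : i \in N 0 -> j \in N 1 ->
  D i j (Z l k) = ((k == i) && (l == j))%:R.
Proof.
move=> iN jN; rewrite mxE /D; case: ifPn => [_|kl]; last first.
  rewrite !mderiv0 scaler0 addr0 scaler0; case: eqP => //= ki; case: eqP => //= lj.
  by move: kl; rewrite ki lj iN jN.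
rewrite !mderivB !mderivZ !mderiv_var !xpair_eqE/= scaler0 subr0 sub0r scalerN scalerA imim.
by rewrite scaleN1r opprK -mulr2n -scalerMnr scalerMnl -[_ *+ 2]mulr_natr mulVf ?scale1r// pnatr_eq0.
Qed.

(** Both parts of the entry have variance 1/(2n). The factor 1/2 is the one in the Wirtinger
    derivative, which leaves 1/n. *)
Let EXe i j a : i \in N 0 -> j \in N 1 -> E (X i j * a) = n%:R^-1 * E (D i j a).
Proof.
move=> iN jN; rewrite mxE iN jN/= mulrDl -scalerAl.
rewrite /E (gaussian_expectationD s0 gY indY) (gaussian_expectationZ s0 gY indY).
rewrite !(gaussian_expectation_by_parts s0 gY indY) !sE//.
rewrite /D (gaussian_expectationZ s0 gY indY) (gaussian_expectationD s0 gY indY).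
rewrite (gaussian_expectationZ s0 gY indY).
have -> : ((2 * n%:R)^-1 : R)%:C%C = 2^-1 * n%:R^-1.
  by rewrite -[LHS]/(real_complex R _) fmorphV rmorphM !rmorph_nat invfM.
move: (gaussian_expectation _ _ _) (gaussian_expectation _ _ _) => x y; ring.
Qed.

Let evalXe w i j : gaussian_eval (part_of_entry Y) w (X i j) =
  (block_proj R (N 0) *m Y w *m block_proj R (N 1)) i j.
Proof.
rewrite mul_mx_diag mul_diag_mx !mxE.
rewrite /gaussian_eval; have [iN|iN] := boolP (i \in N 0); last by rewrite raddf0 !mul0r.
have [jN|jN] := boolP (j \in N 1); last by rewrite raddf0 mulr0.
rewrite mul1r mulr1 raddfD/= mevalZ !mevalXU !enum_rankK /part_of_entry/=.
by case: (Y w i j) => a b; apply/eqP; rewrite eq_complex/=; apply/andP;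
  split; apply/eqP; ring.
Qed.

Let evalZe w i j : gaussian_eval (part_of_entry Y) w (Z j i) =
  adjoint (block_proj R (N 0) *m Y w *m block_proj R (N 1)) j i.
Proof.
rewrite /adjoint [RHS]mxE [X in _ = Num.conj X]mxE -evalXe [in LHS]mxE [in RHS]mxE.
rewrite /gaussian_eval.
case: ifP => _; last by rewrite !raddf0.
rewrite raddfB raddfD/= !mevalZ !mevalXU !enum_rankK /part_of_entry/=.
by case: (Y w i j) => a b; apply/eqP; rewrite eq_complex/=; apply/andP;
  split; apply/eqP; ring.
Qed.

(** Here [e s] is the expected product of the traces with exponents [s]. The existential hides the
    formal polynomials; the limit argument sees only the recursion and the link with
    [partial_trace]. *)
Lemma block_trace_moments : exists e : seq nat -> R[i],
  [/\ e [::] = 1,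
      forall t, e (0%N :: t) = e t *+ #|N 0|,
      forall k t, e (k.+1 :: t) = n%:R^-1 * (e (k :: t) *+ #|N 1|
        + \sum_(l < k) e [:: l.+1, (k.-1 - l)%N & t]
        + \sum_(p < size t) e ((k + nth 0%N t p)%N :: delete_nth t p)
            *+ nth 0%N t p) &
      forall k, partial_trace P (N 0) (fun w =>
        (off_diagonal_block N (Y w) *m adjoint (off_diagonal_block N (Y w))) ^+ k) =
        #|N 0|%:R^-1 * e [:: k] ].
Proof.
have EB : {morph E : p q / p - q}.
  move=> p q; rewrite /E (gaussian_expectationD s0 gY indY) -scaleN1r.
  by rewrite (gaussian_expectationZ s0 gY indY) mulN1r.
pose Em := GRing.isZmodMorphism.Build _ _ E EB.
pose Ea : {additive pol -> R[i]} := HB.pack E Em.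
exists (trace_moment (N 0) Ea X Z); split.
- rewrite trace_moment_nil; exact: (gaussian_expectation1 s0 gY indY).
- by move=> t; exact: trace_moment0.
- move=> k t; apply: (@schwinger_dyson _ _ _ (N 0) (N 1) Ea D n%:R^-1 X Z).
  + by move=> i j a b; rewrite /D !mderivD [im *: (_ + _)]scalerDr addrACA scalerDr.
  + move=> i j a b; rewrite /D !mderivM -!mul_mpolyC; ring.
  + by move=> i j /negbTE ij; rewrite mxE ij.
  + by move=> i j /negbTE ij; rewrite mxE ij.
  + exact: DXe.
  + exact: DZe.
  + exact: EXe.
- move=> k; rewrite /partial_trace; congr (_ * _).
  rewrite /trace_moment /trace_product big_seq1.
  rewrite -[RHS]/(complex_expectation P _); congr complex_expectation.
  apply/funext => w; rewrite /gaussian_eval /block_trace raddf_sum/=.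
  apply: eq_bigr => j jN; rewrite (corner_power _ N01)//.
  set A := block_proj R (N 0) *m Y w *m block_proj R (N 1).
  pose f : {rmorphism pol -> R[i]} :=
    meval (fun i => (part_of_entry Y (enum_val i) w)%:C%C).
  have -> : A *m adjoint A = map_mx f (wishart X Z).
    rewrite /wishart map_mxM; congr (_ *m _).
      by apply/matrixP => a b; rewrite [RHS]mxE -[RHS]/(gaussian_eval _ w _) evalXe.
    by apply/matrixP => a b; rewrite [RHS]mxE -[RHS]/(gaussian_eval _ w _) evalZe.
  by rewrite -rmorphXn mxE.
Qed.

End BlockGaussian.

Lemma cvg_quotient (K : numFieldType) (a m : nat -> K^o) (x y : K^o) : x != 0 ->
  a @ \oo --> x -> m @ \oo --> y -> (fun n => (a n)^-1 * m n) @ \oo --> x^-1 * y.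
Proof. by move=> x0 ax my; apply: cvgM => //; exact: cvgV. Qed.

(** * Normalization of the traces and passage to the limit *)

Section TraceLimit.
Variable R : realType.

Lemma cvg_real_complex (u : nat -> R) (l : R) : u @ \oo --> l ->
  (fun n => (u n)%:C%C : R[i]^o) @ \oo --> (l%:C%C : R[i]^o).
Proof.
move=> ul; apply/(@cvgrPdist_lt _ R[i]^o) => e e0.
have eE : e = (complex.Re e)%:C%C by rewrite RRe_real// ger0_real// ltW.
have e0' : 0 < complex.Re e by move: e0; rewrite eE ltcR.
near=> n; rewrite eE -[X in `|X|]rmorphB/= normc_def/= expr0n addr0 sqrtr_sqr ltcR.
by near: n; move/cvgrPdist_lt : ul; apply.
Unshelve. all: by end_near. Qed.

Lemma cvg_block_trace (disp : nat -> measure_display)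
    (Omega : forall n : nat, measurableType (disp n))
    (P : forall n : nat, probability (Omega n) R)
    (N : forall n : nat, 'I_2 -> {set 'I_n})
    (d : 'I_2 -> R)
    (v : 'M[R]_2)
    (Y : forall n : nat, Omega n -> 'M[R[i]]_n)
    (HN : forall n : nat, (1 < n)%N -> is_interval_partition (N n))
    (Hd : forall q : 'I_2, (fun n : nat => #|N n q|%:R / n%:R : R) @ \oo --> d q)
    (v_ge0 : forall a b : 'I_2, 0 <= v a b)
    (v_12 : v 0 1 = 1)
    (HY : forall n : nat, (1 < n)%N -> is_block_gaussian (P n) (N n) v (Y n))
    (d1_gt0 : 0 < d 0) (k : nat) :
  (fun n => partial_trace (P n) (N n 0) (fun w =>
     (off_diagonal_block (N n) (Y n w) *m adjoint (off_diagonal_block (N n) (Y n w))) ^+ k)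
     : R[i]^o) @ \oo -->
  ((d 0 ^+ k * narayana0 (d 1 / d 0) k)%:C%C : R[i]^o).
Proof.
pose t := d 1 / d 0.
(* For n <= 1 there is no partition into two nonempty blocks; a dummy value is chosen there, and all
   relations hold for large n. *)
have /boolp.choice[e He] : forall n, exists e : seq nat -> R[i], (1 < n)%N -> [/\ e [::] = 1,
      forall t, e (0%N :: t) = e t *+ #|N n 0|,
      forall k t, e (k.+1 :: t) = n%:R^-1 * (e (k :: t) *+ #|N n 1|
        + \sum_(l < k) e [:: l.+1, (k.-1 - l)%N & t]
        + \sum_(p < size t) e ((k + nth 0%N t p)%N :: delete_nth t p)
            *+ nth 0%N t p) &
      forall k, partial_trace (P n) (N n 0) (fun w =>
        (off_diagonal_block (N n) (Y n w) *m adjoint (off_diagonal_block (N n) (Y n w))) ^+ k) =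
        #|N n 0|%:R^-1 * e [:: k] ].
  move=> n; have [n1|n1] := ltnP 1 n; last by exists (fun=> 0).
  have [e He] := block_trace_moments (HN n n1) v_ge0 v_12 (HY n n1).
  by exists e.
pose a n : R[i]^o := (#|N n 0|%:R / n%:R : R)%:C%C.
pose b n : R[i]^o := (#|N n 1|%:R / n%:R : R)%:C%C.
(* Integration by parts supplies one factor 1/n. A cut trace makes the list longer by one and
   absorbs it; a glued one makes it shorter than the left side by one, which leaves 1/n^2. *)
pose r n : R[i]^o := ((n%:R^-1 : R) ^+ 2)%:C%C.
pose m n s : R[i]^o := e n s / n%:R ^+ size s.
pose mu k : R[i]^o := (d 0 ^+ k.+1 * narayana0 t k)%:C%C.
have ratioE p n : (p%:R / n%:R : R)%:C%C = p%:R / n%:R :> R[i].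
  by rewrite -[LHS]/(real_complex R _) fmorph_div !rmorph_nat.
have large : \forall n \near \oo, (1 < n)%N by exists 2%N.
have ca : a @ \oo --> ((d 0)%:C%C : R[i]^o) by exact: cvg_real_complex (Hd 0).
have cb : b @ \oo --> ((d 1)%:C%C : R[i]^o) by exact: cvg_real_complex (Hd 1).
have cr : r @ \oo --> (0 : R[i]^o).
  apply: (@cvg_real_complex (fun n => (n%:R^-1 : R) ^+ 2) 0).
  have c0 : (fun n : nat => n%:R^-1 : R) @ \oo --> (0 : R).
    by rewrite -cvg_shiftS; exact: cvg_harmonic.
  by rewrite -[X in _ --> X](mulr0 (0 : R)); under eq_fun do rewrite expr2; exact: cvgM.
have m_cvg : (m^~ [:: k]) @ \oo --> (mu k : R[i]^o).
  have -> : mu k = \prod_(l <- [:: k]) mu l by rewrite big_seq1.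
  apply: (cvg_normalized_moment cr ca cb).
  - apply: filterS large => n n1; have [e1 _ _ _] := He n n1.
    by rewrite /m e1 expr0 divr1.
  - move=> s; apply: filterS large => n n1; have [_ e0 _ _] := He n n1.
    by rewrite /m /a ratioE e0 /= exprS invfM -mulr_natr; ring.
  - move=> j s; apply: filterS large => n n1; have [_ _ eS _] := He n n1.
    have n0 : n%:R != 0 :> R[i] by rewrite pnatr_eq0 -lt0n ltnW.
    rewrite /m /b /r ratioE eS -[((_)%:C)%C]/(real_complex R _) rmorphXn fmorphV rmorph_nat.
    rewrite 2!mulrDr 2!mulrDl; congr (_ + _ + _).
    + rewrite /= -[e n _ *+ _]mulr_natr exprS.
      move: (n%:R ^+ size s) (expf_neq0 (size s) n0) => z z0.
      by field; rewrite n0 z0.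
    + rewrite -mulrA mulrCA mulr_suml; apply: eq_bigr => l _ /=; rewrite !exprS.
      move: (n%:R ^+ size s) (expf_neq0 (size s) n0) => z z0.
      by field; rewrite n0 z0.
    + rewrite -mulrA mulrCA mulr_suml mulr_sumr; apply: eq_bigr => p _ /=.
      rewrite size_cat size_take size_drop ltn_ord.
      have -> : (p + (size s - p.+1)).+1 = size s by have := ltn_ord p; lia.
      rewrite mulrnAl mulrnAr exprS; congr (_ *+ _).
      move: (n%:R ^+ size s) (expf_neq0 (size s) n0) => z z0.
      by field; rewrite n0 z0.
  - by rewrite /mu /= expr1 mulr1.
  - move=> j; rewrite /mu /= narayana_quadratic -rmorphM.
    rewrite (eq_bigr (fun l : 'I_j =>
      (d 0 ^+ j.+2 * (narayana0 t l.+1 * narayana0 t (j.-1 - l)))%:C%C)); last first.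
      move=> l _; rewrite -rmorphM/=; congr (_%:C)%C.
      have -> : (j.+2 = l.+2 + (j.-1 - l).+1)%N by have := ltn_ord l; lia.
      by rewrite exprD; ring.
    have -> (F : 'I_j -> R) : \sum_l (F l)%:C%C = (\sum_l F l)%:C%C :> R[i].
      by rewrite -[RHS]/(real_complex R _) rmorph_sum.
    rewrite -rmorphD/=; congr (_%:C)%C.
    rewrite -mulr_sumr mulrDr; congr (_ + _).
    by rewrite /t (exprS _ j.+1); field; rewrite gt_eqF.
(* Traces were divided by n, whereas [partial_trace] divides by the size of the block; the quotient
   tends to d_1 > 0 and lowers the power of d_1 by one. *)
have d0C : (d 0)%:C%C != 0 :> R[i] by rewrite fmorph_eq0 gt_eqF.
have -> : (d 0 ^+ k * narayana0 (d 1 / d 0) k)%:C%C = ((d 0)%:C%C)^-1 * mu k :> R[i].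
  rewrite /mu -[((d 0)%:C)%C]/(real_complex R _) -fmorphV -rmorphM/=; congr (_%:C)%C.
  by rewrite exprS -mulrA mulKf ?gt_eqF.
apply: (@cvg_trans _ ((fun n => (a n)^-1 * m n [:: k] : R[i]^o) @ \oo)).
  apply: near_eq_cvg; apply: filterS large => n n1; have [_ _ _ ->] := He n n1.
  have n0 : n%:R != 0 :> R[i] by rewrite pnatr_eq0 -lt0n ltnW.
  by rewrite /a /m ratioE /= expr1 invf_div mulrC mulrA mulfVK// mulrC.
exact: cvg_quotient d0C ca m_cvg.
Qed.

End TraceLimit.

(** * The Marchenko-Pastur distribution *)

Section Semicircle.
Variables (R : realType) (c r : R).
Hypothesis r0 : 0 < r.
Notation mu := (@lebesgue_measure R).

Definition semicircle (x : R) : R := Num.sqrt (r ^+ 2 - (x - c) ^+ 2).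
(* This is asin ((x - c) / r) / 2, in a form that is continuous everywhere. *)
Definition half_asin (x : R) : R := atan ((x - c) / (r + semicircle x)).
Local Notation S := semicircle.
Local Notation H := half_asin.

Let rS x : 0 < r + S x.
Proof. by rewrite ltr_wpDr// sqrtr_ge0. Qed.

Lemma continuous_semicircle : continuous S.
Proof.
move=> x; apply: (@continuous_comp _ _ _ (fun x => r ^+ 2 - (x - c) ^+ 2)); last exact: sqrt_continuous.
apply: cvgB; first exact: cvg_cst.
rewrite expr2; under eq_fun do rewrite expr2.
by apply: cvgM; (apply: cvgB; [exact: cvg_id|exact: cvg_cst]).
Qed.

Lemma continuous_half_asin : continuous H.
Proof.
move=> x; apply: (@continuous_comp _ _ _ (fun x => (x - c) / (r + S x))); last exact: continuous_atan.
apply: cvgM; first by apply: cvgB; [exact: cvg_id|exact: cvg_cst].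
apply: cvgV; first by rewrite gt_eqF.
by apply: cvgD; [exact: cvg_cst|exact: continuous_semicircle].
Qed.

Lemma half_asin_right : H (c + r) = pi / 4.
Proof.
by rewrite /H /S addrC addKr subrr sqrtr0 addr0 divff ?gt_eqF// atan1.
Qed.

Lemma half_asin_left : H (c - r) = - (pi / 4).
Proof.
rewrite /H /S addrC addKr sqrrN subrr sqrtr0 addr0 mulNr divff ?gt_eqF//.
by rewrite atanN atan1.
Qed.

Section Inside.
Variable x : R.
Hypothesis xr : c - r < x < c + r.

Let Q0 : 0 < r ^+ 2 - (x - c) ^+ 2.
Proof.
by rewrite subr_sqr; move: xr => /andP[h1 h2]; apply: mulr_gt0; lra.
Qed.

Lemma semicircle_gt0 : 0 < S x.
Proof. by rewrite sqrtr_gt0. Qed.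

Lemma semicircle_sqr : S x ^+ 2 = r ^+ 2 - (x - c) ^+ 2.
Proof. by rewrite sqr_sqrtr// ltW. Qed.

Lemma is_derive_semicircle : is_derive x 1 S (- (x - c) / S x).
Proof.
have d1 := is_derive_shift c x.
have d2 := is_derive_add (is_derive_cst (r ^+ 2) x 1)
  (is_derive_scale (-1) (is_derive_comp1 (g := fun z : R => z - c) (is_derive_pow 2 (x - c)) d1)).
have -> : S = (fun z => Num.sqrt (r ^+ 2 + -1 * (z - c) ^+ 2)).
  by apply/funext => z; rewrite mulN1r.
have Q0' : 0 < r ^+ 2 + -1 * (x - c) ^+ 2 by rewrite mulN1r.
apply: (is_derive_eq (is_derive_comp1 (g := fun z => r ^+ 2 + -1 * (z - c) ^+ 2)
  (is_derive1_sqrt Q0') d2)).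
rewrite mulN1r /S /= expr1; have := semicircle_gt0; rewrite /S.
by move: (Num.sqrt _) => y y0; field; rewrite gt_eqF.
Qed.

Lemma is_derive_half_asin : is_derive x 1 H (2 * S x)^-1.
Proof.
have d1 := is_derive_shift c x.
have d2 : is_derive x 1 (fun z => r + S z) (- (x - c) / S x).
  by apply: (is_derive_eq (is_derive_add (is_derive_cst r x 1) is_derive_semicircle)); rewrite add0r.
have rSn : r + S x != 0 by rewrite gt_eqF.
have d3 := is_derive_mul d1 (is_deriveV (f := fun z => r + S z) rSn d2).
have -> : H = (fun z => atan ((z - c) / (r + S z))) by [].
apply: (is_derive_eq (is_derive_comp1 (g := fun z => (z - c) / (r + S z))
  (is_derive1_atan _) d3)).
have := semicircle_sqr; have := semicircle_gt0; move: (rS x) => {rSn d3 d2 d1}.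
move: (S x) (x - c) => y z ry y0 yz.
have z2 : z ^+ 2 = r ^+ 2 - y ^+ 2 by rewrite yz; ring.
have ry0 : r + y != 0 by rewrite gt_eqF.
have yn0 : y != 0 by rewrite gt_eqF.
have rn0 : r != 0 by rewrite gt_eqF.
have -> : 1 + (z / (r + y)) ^+ 2 = 2 * r / (r + y).
  by rewrite expr_div_n z2; field.
rewrite (_ : _ + _ = ((r + y) * y + z ^+ 2) / (y * (r + y) ^+ 2)).
  by rewrite z2; field; rewrite yn0 ry0.
by rewrite -[_ *: _]/(_ * _); field; rewrite ?yn0 ?ry0.
Qed.

End Inside.
End Semicircle.

Section ImproperIntegral.
Variable R : realType.
Notation mu := (@lebesgue_measure R).

(** The integrand may be unbounded at [a]. The intervals [c_n, b] increase to ]a, b]: monotone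
    convergence handles the integrals, continuity of [F] the boundary values. *)
Lemma ge0_integral_is_derive_improper (F f : R -> R) (a b : R) : a < b ->
  (forall x, a <= x -> {for x, continuous F}) ->
  (forall x, a < x -> {for x, continuous f}) ->
  (forall x, a < x -> 0 <= f x) ->
  measurable_fun `[a, b] f ->
  (forall x, a < x < b -> is_derive x 1 F (f x)) ->
  (\int[mu]_(x in `[a, b]) (f x)%:E)%E = (F b - F a)%:E.
Proof.
move=> ab cF cf f0 mf dF.
(* The shift by 2 keeps every c_n strictly below b. *)
pose c_ (n : nat) : R := a + (b - a) / n.+2%:R.
have c_gt n : a < c_ n by rewrite ltrDl divr_gt0 ?subr_gt0.
have c_lt n : c_ n < b.
  rewrite -ltrBrDl ltr_pdivrMr// ltr_pMr ?subr_gt0//.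
  by rewrite ltr1n.
have partial n : (\int[mu]_(x in `[c_ n, b]) (f x)%:E)%E = (F b - F (c_ n))%:E.
  apply: integral_is_derive => //.
  - apply: continuous_in_subspaceT => x; rewrite inE/= in_itv/= => /andP[h _].
    by apply: cF; rewrite (le_trans _ h)// ltW.
  - apply: continuous_in_subspaceT => x; rewrite inE/= in_itv/= => /andP[h _].
    by apply: cf; rewrite (lt_le_trans _ h).
  - move=> x /andP[h1 h2]; apply: dF; rewrite h2 andbT.
    exact: lt_trans h1.
have c_cvg : c_ @ \oo --> a.
  rewrite -[X in _ --> X]addr0 -[X in _ + X](mulr0 (b - a)).
  apply: cvgD; first exact: cvg_cst.
  apply: cvgMr; rewrite (cvg_shiftS (fun n => n.+1%:R^-1 : R)).
  exact: cvg_harmonic.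
have Fc : (fun n => F b - F (c_ n)) @ \oo --> F b - F a.
  apply: cvgB; first exact: cvg_cst.
  by apply: continuous_cvg => //; exact: cF.
have U : \bigcup_n `[c_ n, b]%classic = `]a, b]%classic.
  apply/seteqP; split => x /=.
    by move=> [n _] /=; rewrite !in_itv/= => /andP[h ->]; rewrite (lt_le_trans _ h).
  rewrite in_itv/= => /andP[ax xb].
  have [n /ltW cx] : exists n, c_ n < x.
    have : \forall n \near \oo, c_ n < x.
      by move/cvgrPdist_lt : c_cvg => /(_ (x - a)); rewrite subr_gt0 => /(_ ax);
        apply: filterS => n; rewrite distrC ger0_norm ?subr_ge0 ?(ltW (c_gt _))// ltrD2r.
    by move=> [n _ /(_ n)]; rewrite /= leqnn => /(_ isT) ?; exists n.
  by exists n => //=; rewrite in_itv/= cx xb.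
have lim : (fun n => \int[mu]_(x in `[c_ n, b]) (f x)%:E)%E @ \oo -->
    (\int[mu]_(x in `]a, b]) (f x)%:E)%E.
  rewrite -U; apply: ge0_nondecreasing_set_cvg_integral => //.
  - apply/nondecreasing_seqP => n; apply/subsetPset => x /=; rewrite !in_itv/=.
    move=> /andP[h ->]; rewrite andbT (le_trans _ h)// lerD2l ler_pM2l ?subr_gt0//.
    by rewrite lef_pV2 ?posrE// ler_nat.
  - move=> n; apply/measurable_EFinP; apply: measurable_funS mf => //.
    apply: subset_itvr; rewrite bnd_simp; exact: ltW.
  - move=> n x /=; rewrite in_itv/= => /andP[h _].
    by rewrite lee_fin f0// (lt_le_trans _ h).
rewrite -integral_itv_obnd_cbnd; last first.
  apply/measurable_EFinP; apply: measurable_funS mf => //.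
  by apply: subset_itvr; rewrite bnd_simp.
apply: (cvg_unique _ lim) => //.
rewrite (_ : (fun n => _) = EFin \o (fun n => F b - F (c_ n))).
  by apply: cvg_EFin => //; near=> n.
by apply/funext => n /=.
Unshelve. all: by end_near. Qed.

End ImproperIntegral.

(** * Mass and moments of the absolutely continuous part, for t > 0 *)

Section MarchenkoPasturDensity.
Variables (R : realType) (t : R).
Hypothesis t0 : 0 < t.
Notation mu := (@lebesgue_measure R).

(** The support has centre [c] and half-length [r], and q^2 is the product of its end points. *)
Let c := 1 + t.
Let r := 2 * Num.sqrt t.
Let q := `|1 - t|.
Local Notation S := (semicircle c r).
Local Notation H := (half_asin c r).

Let r0 : 0 < r. Proof. by rewrite mulr_gt0// sqrtr_gt0. Qed.
Let rr : r ^+ 2 = 4 * t. Proof. by rewrite exprMn sqr_sqrtr ?ltW//; ring. Qed.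
Let qq : q ^+ 2 = c ^+ 2 - r ^+ 2.
Proof. by rewrite real_normK ?num_real// rr /c; ring. Qed.

Let leftE : mp_left t = c - r.
Proof.
have e (s : R) : s ^+ 2 = t -> (1 - s) ^+ 2 = 1 + t - 2 * s by move=> <-; ring.
by rewrite /mp_left e// sqr_sqrtr// ltW.
Qed.

Let rightE : mp_right t = c + r.
Proof.
have e (s : R) : s ^+ 2 = t -> (1 + s) ^+ 2 = 1 + t + 2 * s by move=> <-; ring.
by rewrite /mp_right e// sqr_sqrtr// ltW.
Qed.

Let left_ge0 : 0 <= c - r. Proof. by rewrite -leftE sqr_ge0. Qed.
Let left_lt_right : c - r < c + r. Proof. by rewrite ltrD2l gtrN. Qed.

Let densityE x : mp_density t x = S x / (2 * pi * x) * \1_`[c - r, c + r] x.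
Proof.
rewrite /mp_density leftE rightE /semicircle; congr (Num.sqrt _ / _ * _); ring.
Qed.

Let G m (x : R) := x ^+ m * S x.

Let continuous_G m : continuous (G m).
Proof.
by move=> x; apply: cvgM; [exact: exprn_continuous|exact: continuous_semicircle].
Qed.

Let density_powE k x : x ^+ k.+1 * mp_density t x =
  (2 * pi)^-1 * G k x * \1_`[c - r, c + r] x.
Proof.
rewrite densityE mulrA indicE; have [|] := boolP (x \in _); last by rewrite !mulr0.
rewrite inE /= in_itv/= !mulr1 => /andP[cx _].
have [->|x0] := eqVneq x 0.
  (* At 0 the radicand is -q^2 <= 0, so the square root is 0 and the default value of 1/0 does no
     harm. *)
  rewrite expr0n/= mul0r /G (_ : S 0 = 0) ?mulr0//.
  by apply: ler0_sqrtr; rewrite sub0r sqrrN -opprB -qq oppr_le0 sqr_ge0.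
have p0 : pi != 0 :> R by rewrite gt_eqF// pi_gt0.
by rewrite /G exprS; move: (@pi R) p0 => p p0; field; rewrite p0 x0.
Qed.

Let iG m : mu.-integrable `[c - r, c + r] (EFin \o G m).
Proof.
apply: continuous_compact_integrable; first exact: segment_compact.
exact: continuous_subspaceT.
Qed.

Lemma integrable_pow_mp_density k :
  mu.-integrable setT (fun x => (x ^+ k.+1 * mp_density t x)%:E).
Proof.
rewrite (_ : (fun x => _) = (fun x => ((2 * pi)^-1)%:E * (EFin \o G k) x)%E \_ `[c - r, c + r]).
  by apply/(integrable_mkcond _ _).1 => //; apply: integrableZl => //; exact: iG.
apply/funext => x; rewrite density_powE patchE indicE.
by case: ifP => _; rewrite ?mulr1 ?mulr0.
Qed.

Let integral_pow k : \int[mu]_x (x ^+ k.+1 * mp_density t x) =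
  (2 * pi)^-1 * \int[mu]_(x in `[c - r, c + r]) G k x.
Proof.
rewrite -RintegralZl//.
rewrite [RHS]Rintegral_mkcond; apply: eq_Rintegral => x _.
rewrite density_powE patchE indicE.
by case: ifP => _; rewrite ?mulr1 ?mulr0.
Qed.

Let inside x : c - r < x < c + r -> 0 < S x /\ S x ^+ 2 = r ^+ 2 - (x - c) ^+ 2.
Proof. by move=> h; split; [exact: semicircle_gt0|exact: semicircle_sqr]. Qed.

Let endpoint (s : R) : s ^+ 2 = r ^+ 2 -> S (c + s) = 0.
Proof. by move=> s2; rewrite /semicircle (addrC c) addrK s2 subrr sqrtr0. Qed.

Let S_right : S (c + r) = 0. Proof. exact: endpoint. Qed.
Let S_left : S (c - r) = 0. Proof. by apply: endpoint; rewrite sqrrN. Qed.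

(** The area of a half disc of radius r, where r^2 = 4t; [r ^+ 2 * H x] is the usual term (r^2/2)
    asin((x - c)/r). *)
Let area : \int[mu]_(x in `[c - r, c + r]) G 0 x = 2 * pi * t.
Proof.
pose F x := 2^-1 * ((x - c) * S x) + r ^+ 2 * H x.
transitivity (fine (F (c + r) - F (c - r))%:E).
  congr fine; apply: (integral_is_derive left_lt_right).
- apply: continuous_subspaceT => x; apply: cvgD; apply: cvgM; try exact: cvg_cst.
    apply: cvgM; last exact: continuous_semicircle.
    by apply: cvgB; [exact: cvg_id|exact: cvg_cst].
  exact: continuous_half_asin.
- exact: continuous_subspaceT.
- move=> x xr; have [S0 S2] := inside xr.
  apply: (is_derive_eq (is_derive_add
    (is_derive_scale 2^-1 (is_derive_mul (is_derive_shift c x) (is_derive_semicircle xr)))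
    (is_derive_scale (r ^+ 2) (is_derive_half_asin r0 xr)))).
  rewrite /G expr0 !mul1r; move: (S x) S0 S2 => y y0 y2.
  have -> : r ^+ 2 = y ^+ 2 + (x - c) ^+ 2 by rewrite y2; ring.
  by field; rewrite gt_eqF.
- rewrite /= /F S_right S_left half_asin_right// half_asin_left// rr.
  by move: (@pi R) => p; field.
Qed.

(* Integrates the derivative of x^m (r^2 - (x - c)^2)^(3/2). *)
Let recurrence m :
  m.+3%:R * \int[mu]_(x in `[c - r, c + r]) G m.+1 x =
  m.*2.+3%:R * c * \int[mu]_(x in `[c - r, c + r]) G m x -
  m%:R * q ^+ 2 * \int[mu]_(x in `[c - r, c + r]) G m.-1 x.
Proof.
pose F x := x ^+ m * ((r ^+ 2 - (x - c) ^+ 2) * S x).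
pose f x := - m.+3%:R * G m.+1 x + (m.*2.+3%:R * c * G m x - m%:R * q ^+ 2 * G m.-1 x).
have iZ (k : R) j : mu.-integrable `[c - r, c + r] (EFin \o (fun x => k * G j x)).
  rewrite (_ : EFin \o _ = (fun x => k%:E * (EFin \o G j) x)%E)//.
  by apply: integrableZl => //; exact: iG.
have : \int[mu]_(x in `[c - r, c + r]) f x = 0.
  transitivity (fine (F (c + r) - F (c - r))%:E); last first.
    by rewrite /= /F S_right S_left !mulr0 subr0.
  congr fine; apply: (integral_is_derive left_lt_right).
  - apply: continuous_subspaceT => x; apply: cvgM; first exact: exprn_continuous.
    apply: cvgM; last exact: continuous_semicircle.
    apply: cvgB; first exact: cvg_cst.
    rewrite expr2; under eq_fun do rewrite expr2.
    by apply: cvgM; (apply: cvgB; [exact: cvg_id|exact: cvg_cst]).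
  - have cZ (k : R) j : continuous (fun x => k * G j x).
      by move=> x; apply: cvgM; [exact: cvg_cst|exact: continuous_G].
    apply: continuous_subspaceT => x; apply: cvgD; first exact: cZ.
    by apply: cvgB; exact: cZ.
  - move=> x xr; have [S0 S2] := inside xr.
    have dQ := is_derive_add (is_derive_cst (r ^+ 2) x 1)
      (is_derive_scale (-1) (is_derive_comp1 (g := fun z : R => z - c)
         (is_derive_pow 2 (x - c)) (is_derive_shift c x))).
    have dF := is_derive_mul (is_derive_pow m x)
      (is_derive_mul dQ (is_derive_semicircle xr)).
    rewrite (_ : F = fun z => z ^+ m * ((r ^+ 2 + -1 * (z - c) ^+ 2) * S z)); last first.
      by apply/funext => z; rewrite mulN1r.
    apply: (is_derive_eq dF); rewrite /f /G qq.
    have -> : m.*2.+3%:R = 2 * m%:R + 3 :> R.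
      by rewrite -addn3 natrD -muln2 natrM mulrC.
    have -> : m.+3%:R = m%:R + 3 :> R by rewrite -addn3 natrD.
    move: (S x) S0 S2 => y y0 y2.
    have y0' : y != 0 by rewrite gt_eqF.
    have -> : r ^+ 2 + -1 * (x - c) ^+ 2 = y ^+ 2 by rewrite y2; ring.
    have -> : c ^+ 2 - r ^+ 2 = 2 * c * x - x ^+ 2 - y ^+ 2 by rewrite y2; ring.
    case: m {F f dF} => [|m]; first by rewrite /= !expr0 expr1; field.
    by rewrite /= !exprS expr0; field.
have iB : mu.-integrable `[c - r, c + r]
    (EFin \o (fun x => m.*2.+3%:R * c * G m x - m%:R * q ^+ 2 * G m.-1 x)).
  rewrite (_ : EFin \o _ = (fun x => (EFin \o (fun x => m.*2.+3%:R * c * G m x)%R) x -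
    (EFin \o (fun x => m%:R * q ^+ 2 * G m.-1 x)%R) x)%E)//.
  by apply: (integrableB _ (iZ (m.*2.+3%:R * c) m) (iZ (m%:R * q ^+ 2) m.-1)).
rewrite (RintegralD _ (iZ (- m.+3%:R) m.+1) iB)//.
rewrite (RintegralB _ (iZ (m.*2.+3%:R * c) m) (iZ (m%:R * q ^+ 2) m.-1))//.
rewrite !RintegralZl//; try exact: iG.
by move=> h; apply/eqP; rewrite -subr_eq0 -oppr_eq0; apply/eqP; rewrite -h; ring.
Qed.

(** [recurrence] is the three-term recurrence, because c = 1 + t and q^2 = (1 - t)^2. The first
    moment is the area divided by 2 pi, namely t. *)
Lemma mp_density_moment k :
  \int[mu]_x (x ^+ k.+1 * mp_density t x) = narayana_poly k.+1 t.
Proof.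
pose f k := \int[mu]_x (x ^+ k * mp_density t x).
apply: (@three_term_unique _ t f (fun k => narayana_poly k t)).
- move=> m; rewrite /f !integral_pow mulrCA recurrence.
  rewrite real_normK ?num_real// mulrBr; congr (_ - _); first by rewrite -/c; ring.
  case: m => [|m]; first by rewrite !mul0r mulr0.
  by rewrite integral_pow; ring.
- exact: narayana_poly_three_term.
- rewrite /f integral_pow area mulrA mulVf ?mul1r.
    rewrite /narayana_poly big_nat1 /narayana_number.
    by rewrite bin0 bin0 !mulr1 invr1 mul1r expr1.
  by rewrite mulf_neq0// gt_eqF// pi_gt0.
Qed.

(** The value arises as (c - q)/2 = (1 + t - |1 - t|)/2, and it complements the atom max(1 - t, 0)
    to total mass 1. *)
Lemma mp_density_mass : (\int[mu]_x (mp_density t x)%:E = (Num.min 1 t)%:E)%E.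
Proof.
have p0 : pi != 0 :> R by rewrite gt_eqF// pi_gt0.
pose f x := S x / (2 * pi * x).
(* The inversion x |-> q^2 / x exchanges the end points c - r and c + r. When
   t = 1 the last term vanishes, q^2 / 0 being 0, but f is unbounded near 0. *)
pose F x := (2 * pi)^-1 * (S x + (2 * c * H x + 2 * q * H (q ^+ 2 / x))).
have ab : (c - r) * (c + r) = q ^+ 2 by rewrite qq; ring.
transitivity (\int[mu]_(x in `[(c - r)%R, (c + r)%R]) (f x)%:E)%E.
  rewrite [RHS]integral_mkcond; apply: eq_integral => x _.
  by rewrite densityE patchE indicE; case: ifP => _; rewrite ?mulr1 ?mulr0.
have right0 : c + r != 0 by rewrite gt_eqF// (le_lt_trans left_ge0).
have left0 : q != 0 -> 0 < c - r.
  move=> q0; rewrite lt_neqAle left_ge0 andbT eq_sym; apply/eqP => e.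
  by move: ab; rewrite e mul0r => /esym/eqP; rewrite sqrf_eq0 (negbTE q0).
transitivity ((F (c + r) - F (c - r))%:E); last first.
  have e1 : q * H (q ^+ 2 / (c + r)) = - (q * (pi / 4)).
    by rewrite -ab mulfK// half_asin_left// mulrN.
  have e2 : q * H (q ^+ 2 / (c - r)) = q * (pi / 4).
    have [->|q0] := eqVneq q 0; first by rewrite !mul0r.
    by rewrite -ab (mulrC (c - r)) mulfK ?half_asin_right// gt_eqF// left0.
  rewrite /F S_right S_left half_asin_right// half_asin_left// -!(mulrA 2 q) e1 e2.
  congr EFin; transitivity (2^-1 * (c - q)).
    by move: (@pi R) p0 => p p0; field; rewrite p0.
  rewrite /c /q; have [t1|t1] := leP t 1.
    by rewrite ger0_norm ?subr_ge0//; field.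
  by rewrite ltr0_norm ?subr_lt0//; field.
have cS : continuous S by exact: continuous_semicircle.
have cH : continuous H by exact: continuous_half_asin.
have pos x : c - r < x -> 0 < x by exact: le_lt_trans.
apply: ge0_integral_is_derive_improper => //.
- move=> x ax; apply: cvgM; first exact: cvg_cst.
  apply: cvgD; first exact: cS.
  apply: cvgD; first by apply: cvgM; [exact: cvg_cst|exact: cH].
  have [q0|q0] := eqVneq q 0.
    by rewrite q0 mulr0; under eq_fun do rewrite mul0r; rewrite mul0r; exact: cvg_cst.
  apply: cvgM; first exact: cvg_cst.
  apply: continuous_cvg; first exact: cH.
  apply: cvgM; first exact: cvg_cst.
  by apply: cvgV; [rewrite gt_eqF// (lt_le_trans (left0 q0))|exact: cvg_id].
- move=> x ax; apply: cvgM; first exact: cS.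
  apply: cvgV; first by rewrite mulf_neq0 ?mulf_neq0// gt_eqF// pos.
  by apply: cvgM; [exact: cvg_cst|exact: cvg_id].
- move=> x ax; rewrite /f divr_ge0 ?sqrtr_ge0// !mulr_ge0 ?pi_ge0//.
  by rewrite ltW// pos.
- apply: (@eq_measurable_fun _ _ _ _ _ (mp_density t)).
    by move=> x xD; rewrite densityE indicE xD mulr1.
  by apply: measurable_funTS; exact: measurable_mp_density.
- move=> x xr; have [S0 S2] := inside xr; have [ax xb] := andP xr.
  have x0 := pos x ax.
  have dSH := is_derive_add (is_derive_semicircle xr)
    (is_derive_scale (2 * c) (is_derive_half_asin r0 xr)).
  have y2 : - x ^+ 2 + 2 * c * x - q ^+ 2 = S x ^+ 2 by rewrite S2 qq; ring.
  have [q0|q0] := eqVneq q 0.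
    rewrite /F (_ : (fun z => _) =
        (fun z => (2 * pi)^-1 * (S z + 2 * c * H z))); last first.
      by apply/funext => z; rewrite q0 mulr0 mul0r addr0.
    apply: (is_derive_eq (is_derive_scale (2 * pi)^-1 dSH)).
    rewrite /f; move: (S x) S0 y2 (@pi R) p0 => y y0 y2 p p0.
    have y0' : y != 0 by rewrite gt_eqF.
    have x0' : x != 0 by rewrite gt_eqF.
    transitivity ((2 * p)^-1 * ((- x ^+ 2 + 2 * c * x - q ^+ 2) / (x * y))).
      by rewrite q0; field; rewrite ?p0 ?x0' ?y0'.
    by rewrite y2; field; rewrite ?p0 ?x0' ?y0'.
  have a0 := left0 q0.
  have xr' : c - r < q ^+ 2 / x < c + r.
    by rewrite ltr_pdivlMr// ltr_pdivrMr// -ab ltr_pM2l// xb mulrC ltr_pM2l ?ax// (lt_trans x0).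
  (* The inversion multiplies the radicand by (q/x)^2, so the derivative of [H (q ^+ 2 / x)] has
     [S x] in its denominator like the other terms; the sum of the numerators is then [S x]
     squared. *)
  have Sinv : S (q ^+ 2 / x) = q / x * S x.
    rewrite /semicircle (_ : r ^+ 2 - (q ^+ 2 / x - c) ^+ 2 =
       (q / x) ^+ 2 * (r ^+ 2 - (x - c) ^+ 2)); last first.
      have -> : r ^+ 2 = c ^+ 2 - q ^+ 2 by rewrite qq; ring.
      by field; rewrite gt_eqF.
    rewrite sqrtrM ?sqr_ge0// sqrtr_sqr ger0_norm// divr_ge0 ?normr_ge0//.
    exact: ltW.
  have dinv := is_derive_scale (q ^+ 2) (is_deriveV (f := id) (lt0r_neq0 x0) (is_derive_id x (1 : R))).
  have dH2 := is_derive_comp1 (g := fun z => q ^+ 2 * z^-1) (is_derive_half_asin r0 xr') dinv.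
  have dF := is_derive_scale (2 * pi)^-1 (is_derive_add (is_derive_semicircle xr)
    (is_derive_add (is_derive_scale (2 * c) (is_derive_half_asin r0 xr))
       (is_derive_scale (2 * q) dH2))).
  apply: (is_derive_eq dF); rewrite /f Sinv.
  move: (S x) S0 y2 (@pi R) p0 => y y0 y2 p p0.
  have y0' : y != 0 by rewrite gt_eqF.
  have x0' : x != 0 by rewrite gt_eqF.
  transitivity ((2 * p)^-1 * ((- x ^+ 2 + 2 * c * x - q ^+ 2) / (x * y))).
    by rewrite -[_ *: _]/(_ * _); field; rewrite ?p0 ?x0' ?y0' ?q0.
  by rewrite y2; field; rewrite ?p0 ?x0' ?y0'.
Qed.

End MarchenkoPasturDensity.

(** * Moments and support of the dilated law *)

Section MarchenkoPasturMoments.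
Variable R : realType.
Notation leb := (@lebesgue_measure R).

Definition has_moments (mu : {measure set R -> \bar R}) (m : nat -> R) : Prop :=
  forall k, mu.-integrable setT (fun x : R => (x ^+ k)%:E) /\
    (\int[mu]_x (x ^+ k)%:E = (m k)%:E)%E.

Let mpow k : measurable_fun [set: R] (fun x : R => (x ^+ k)%:E).
Proof. by apply/measurable_EFinP; exact: exprn_measurable. Qed.

Lemma has_moments_mass mu m : has_moments mu m -> (mu setT = (m 0%N)%:E)%E.
Proof.
move=> /(_ 0%N)[_ <-]; transitivity (\int[mu]_x (cst 1%E x))%E => //.
by rewrite integral_cst// mul1e.
Qed.

Lemma has_moments_add (mu nu : {measure set R -> \bar R}) m m' :
  has_moments mu m -> has_moments nu m' ->
  has_moments (measure_add mu nu) (fun k => m k + m' k).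
Proof.
move=> hm hm' k; have [i1 e1] := hm k; have [i2 e2] := hm' k; split.
  apply/integrableP; split => //; rewrite ge0_integral_measure_add//; last first.
    exact: measurableT_comp.
  by apply: lte_add_pinfty; [case/integrableP: i1|case/integrableP: i2].
by rewrite integral_measure_add// e1 e2.
Qed.

Lemma has_moments_density d (T : measurableType d) (mu : {measure set T -> \bar R})
    (nu : {measure set R -> \bar R}) (phi : T -> R) (h : T -> R) m :
  measurable_fun setT phi -> measurable_fun setT h -> (forall x, 0 <= h x) ->
  (forall A, measurable A -> nu A = \int[mu]_(x in phi @^-1` A) (h x)%:E)%E ->
  (forall k, mu.-integrable setT (fun x => (phi x ^+ k * h x)%:E)) ->
  (forall k, \int[mu]_x (phi x ^+ k * h x) = m k) ->
  has_moments nu m.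
Proof.
move=> mphi mh h0 nuE ih eh k.
have mk : measurable_fun [set: R] (fun x : R => x ^+ k) by exact: exprn_measurable.
have ink := (integrable_density mphi mh h0 nuE mk).2 (ih k).
split => //; rewrite -eh -(integral_density mphi mh h0 nuE mk) fineK//.
exact: integrable_fin_num.
Qed.

Lemma has_moments_scaled_dirac (c : {nonneg R}) (a : R) :
  has_moments (mscale c \d_a) (fun k => c%:num * a ^+ k).
Proof.
have meas k : measurable_fun [set: R] (fun x => (x ^+ k * c%:num)%:E).
  by apply/measurable_EFinP; apply: measurable_funM => //; exact: exprn_measurable.
apply: (@has_moments_density _ _ (dirac a) _ id (cst c%:num)) => //.
- move=> A mA; transitivity (\int[dirac a]_(x in A) cst c%:num%:E x)%E => //.
  by rewrite integral_cst.
- move=> k; apply/integrableP; split => //.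
  rewrite integral_dirac//; last exact: measurableT_comp.
  by rewrite diracT mul1e ltry.
- by move=> k; rewrite /Rintegral integral_dirac// diracT mul1e mulrC.
Qed.

Let narayana_poly_at0 k : narayana_poly k.+1 0 = 0 :> R.
Proof.
rewrite /narayana_poly big_add1 big1// => j _.
by rewrite expr0n mulr0.
Qed.

Lemma mp_continuous_moments (t : R) : 0 <= t ->
  has_moments (mp_continuous t)
    (fun k => if k is 0%N then Num.min 1 t else narayana_poly k t).
Proof.
move=> t0.
have mdens : @measurable_fun _ _ (measurableTypeR R) R setT (mp_density t).
  exact: measurable_mp_density.
have mid : @measurable_fun _ _ (measurableTypeR R) R setT id by exact: measurable_id.
have meas k : @measurable_fun _ _ (measurableTypeR R) _ setT
    (fun x : R => (x ^+ k * mp_density t x)%:E).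
  apply/measurable_EFinP; apply: measurable_funM => //; exact: exprn_measurable.
apply: (@has_moments_density _ (measurableTypeR R) leb _ id (mp_density t)) => //.
- by move=> x; exact: mp_density_ge0.
(* At t = 0 the indicator is that of the single point 1, and integrals over it vanish. *)
- move=> k; move: t0; rewrite le_eqVlt => /predU1P[t0|t0].
    pose g (x : R) := x ^+ k * (Num.sqrt ((x - 1) * (1 - x)) / (2 * pi * x)).
    apply/integrableP; split=> //.
    rewrite (_ : (\int[leb]_x _ = 0)%E)//.
    transitivity (\int[leb]_(x in [set 1%R]) `|(g x)%:E|)%E; last exact: integral_set1.
    rewrite [RHS]integral_mkcond; apply: eq_integral => x _.
    rewrite patchE /mp_density /mp_left /mp_right -t0 sqrtr0 subr0 addr0 expr1n set_itv1 indicE.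
    by case: ifP => _; rewrite ?mulr1// !mulr0 abse0.
  case: k => [|k]; last exact: integrable_pow_mp_density.
  apply/integrableP; split => //.
  under eq_integral do rewrite /= expr0 mul1r ger0_norm ?mp_density_ge0//.
  by rewrite mp_density_mass// ltry.
- move=> k; move: t0; rewrite le_eqVlt => /predU1P[t0|t0].
    transitivity (\int[leb]_(x in [set (1 : R)]) (x ^+ k * (Num.sqrt ((x - 1) * (1 - x)) / (2 * pi * x)))).
      rewrite [RHS]Rintegral_mkcond; apply: eq_Rintegral => x _.
      rewrite patchE /mp_density /mp_left /mp_right -t0 sqrtr0 subr0 addr0 expr1n set_itv1 indicE.
      by case: ifP => _; rewrite ?mulr1// !mulr0.
    rewrite Rintegral_set1 -t0; case: k => [|k]; last by rewrite narayana_poly_at0.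
    by rewrite (min_idPr _).
  case: k => [|k]; last exact: mp_density_moment.
  under eq_Rintegral do rewrite expr0 mul1r.
  by rewrite /Rintegral mp_density_mass.
Qed.

Lemma marchenko_pastur_moments (t : R) : 0 <= t ->
  has_moments (marchenko_pastur t) (narayana0 t).
Proof.
move=> t0; rewrite (_ : narayana0 t = fun k => Num.max (1 - t) 0 * 0 ^+ k +
    (if k is 0%N then Num.min 1 t else narayana_poly k t)).
  apply: has_moments_add; last exact: mp_continuous_moments.
  exact: has_moments_scaled_dirac.
apply/funext => -[|k]; last by rewrite /= expr0n/= mulr0 add0r.
rewrite /= expr0 mulr1; have [t1|t1] := leP t 1.
  by rewrite (max_idPl _) ?subr_ge0// subrK.
by rewrite (max_idPr _) ?add0r// subr_le0 ltW.
Qed.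

Lemma dilation_moments (lambda : R) (mu : {measure set R -> \bar R}) m :
  has_moments mu m -> has_moments (dilation lambda mu) (fun k => lambda ^+ k * m k).
Proof.
move=> hm.
have iZ k : mu.-integrable setT (fun x => (lambda ^+ k)%:E * (x ^+ k)%:E)%E.
  by apply: integrableZl => //; case: (hm k).
apply: (@has_moments_density _ _ mu _ ( *%R lambda) (cst 1)) => //.
- move=> A mA; transitivity (\int[mu]_(x in *%R lambda @^-1` A) cst 1%E x)%E => //.
  have ml : measurable_fun [set: R] ( *%R lambda) by exact: measurable_funM.
  by rewrite integral_cst ?mul1e//; rewrite -[X in measurable X]setTI; exact: ml.
- move=> k; apply: eq_integrable (iZ k) => // x _.
  by rewrite exprMn mulr1.
- move=> k; under eq_Rintegral do rewrite exprMn mulr1.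
  rewrite RintegralZl//; last by case: (hm k).
  by rewrite /Rintegral; case: (hm k) => _ ->.
Qed.

Lemma dilation_mp_support (lambda t : R) : 0 < lambda ->
  dilation lambda (marchenko_pastur t)
    (~` `[- (lambda * mp_right t), lambda * mp_right t]) = 0%E.
Proof.
move=> l0; set A := ~` _.
have r0 : 0 <= mp_right t by exact: sqr_ge0.
have mA : measurable A by exact: measurableC.
rewrite /dilation /pushforward /marchenko_pastur.
etransitivity; first exact: measure_addE.
have notA x : A (lambda * x) -> ~ (0 <= x <= mp_right t).
  move=> Ax /andP[x0 xr]; apply: Ax; rewrite /= in_itv/= ler_pM2l// xr andbT.
  by rewrite (@le_trans _ _ 0)// ?oppr_le0 mulr_ge0// ltW.
have d0 : dirac (0 : R) ( *%R lambda @^-1` A) = 0%E :> \bar R.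
  by rewrite diracE memNset// => /notA; apply; rewrite lexx.
rewrite [X in (X + _)%E](_ : _ = 0%E) ?add0e; last first.
  by apply: (@eq_trans _ _ (_ * 0)%E); [congr (_ * _)%E; exact: d0|exact: mule0].
apply: integral0_eq => x /notA xA; rewrite /mp_density indicE memNset ?mulr0//.
rewrite /= in_itv/= => /andP[h1 h2]; apply: xA; rewrite h2 andbT.
by rewrite (le_trans _ h1)// sqr_ge0.
Qed.

End MarchenkoPasturMoments.

(** * Determinacy of compactly supported laws *)

Section StepPolynomials.
Variable R : realType.

Lemma bernoulli_lower (u : R) N : 0 <= u <= 1 -> 1 - N%:R * u <= (1 - u) ^+ N.
Proof.
move=> /andP[u0 u1]; elim: N => [|N IH]; first by rewrite mul0r subr0 expr0.
rewrite exprS; apply: (@le_trans _ _ ((1 - u) * (1 - N%:R * u))).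
  rewrite -subr_ge0 -natr1 (_ : _ - _ = N%:R * u ^+ 2); last by ring.
  by rewrite mulr_ge0// sqr_ge0.
by rewrite ler_wpM2l// subr_ge0.
Qed.

Lemma bernoulli_upper (u : R) N : 0 <= u <= 1 -> N%:R * u * (1 - u) ^+ N <= 1.
Proof.
move=> /andP[u0 u1].
(* The stronger form is inductive, since (1 + (N + 1) u)(1 - u) <= 1 + N u. *)
suff : (1 + N%:R * u) * (1 - u) ^+ N <= 1.
  by apply: le_trans; rewrite ler_wpM2r ?exprn_ge0 ?subr_ge0// lerDr.
elim: N => [|N IH]; first by rewrite mul0r addr0 mul1r expr0.
rewrite exprS mulrA; apply: le_trans IH; rewrite ler_wpM2r ?exprn_ge0 ?subr_ge0//.
rewrite -subr_ge0 -natr1 (_ : _ - _ = (N%:R + 1) * u ^+ 2); last by ring.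
by rewrite mulr_ge0// ?sqr_ge0// addr_ge0.
Qed.

(** With w the square root of z, one factor w^n keeps n w^n below 1/(1 - w), by [bernoulli_upper] at
    u = 1 - w, and the other tends to 0. *)
Lemma cvg_natmul_expr (z : R) : 0 <= z < 1 -> (fun n => n%:R * z ^+ n) @ \oo --> (0 : R).
Proof.
move=> /andP[z0 z1]; pose w := Num.sqrt z.
have w0 : 0 <= w by rewrite sqrtr_ge0.
have w1 : w < 1 by rewrite -sqrtr1 ltr_sqrt.
have zw : z = w ^+ 2 by rewrite sqr_sqrtr.
have w1' : 0 < 1 - w by rewrite subr_gt0.
apply: (@squeeze_cvgr _ _ _ _ (cst 0) (fun n => (1 - w)^-1 * w ^+ n)).
- near=> n; rewrite mulr_ge0 ?exprn_ge0//= zw -exprM mul2n -addnn exprD mulrA.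
  rewrite ler_wpM2r ?exprn_ge0// -[leRHS]mul1r ler_pdivlMr//.
  have := @bernoulli_upper (1 - w) n; rewrite subKr mulrAC; apply.
  by rewrite ltW//= lerBlDr lerDl.
- exact: cvg_cst.
- rewrite -[X in _ --> X](mulr0 (1 - w)^-1); apply: cvgMr.
  by apply: cvg_expr; rewrite ger0_norm.
Unshelve. all: by end_near. Qed.

(** With u = y^n and N = n 2^n, the product N u = n (2y)^n decides the limit. It tends to 0 for y <
    1/2, where [bernoulli_lower] gives limit 1; it is at least n for y >= 1/2, where
    [bernoulli_upper] gives the bound 1/n. *)
Definition step_function (n : nat) (y : R) : R := (1 - y ^+ n) ^+ (n * 2 ^ n).

Lemma step_function_itv n y : 0 <= y <= 1 -> 0 <= step_function n y <= 1.
Proof.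
move=> /andP[y0 y1]; have h : 0 <= 1 - y ^+ n by rewrite subr_ge0 exprn_ile1.
by rewrite exprn_ge0//= exprn_ile1// lerBlDr lerDl exprn_ge0.
Qed.

Lemma cvg_step_function y : 0 <= y <= 1 ->
  step_function^~ y @ \oo --> ((y < 2^-1)%R%:R : R).
Proof.
move=> y01; have /andP[y0 y1] := y01.
have yn n : 0 <= y ^+ n <= 1 by rewrite exprn_ge0//= exprn_ile1.
have [y2|y2] := ltP y 2^-1.
  apply: (@squeeze_cvgr _ _ _ _ (fun n => 1 - n%:R * (2 * y) ^+ n) (cst 1)).
  - near=> n; have /andP[_ ->] := step_function_itv n y01; rewrite andbT.
    apply: le_trans (bernoulli_lower (n * 2 ^ n) (yn n)).
    by rewrite natrM natrX exprMn mulrA.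
  - rewrite -[X in _ --> X]subr0; apply: cvgB; first exact: cvg_cst.
    apply: cvg_natmul_expr; rewrite mulr_ge0//= mulrC -ltr_pdivlMr//.
    by rewrite mul1r.
  - exact: cvg_cst.
apply: (@squeeze_cvgr _ _ _ _ (cst 0) (fun n => n%:R^-1)).
- near=> n; have /andP[-> _] /= := step_function_itv n y01.
  have n0 : 0 < n%:R :> R by rewrite ltr0n; near: n; exists 1%N.
  rewrite -[leRHS]mul1r ler_pdivlMr// mulrC.
  apply: le_trans (bernoulli_upper (n * 2 ^ n) (yn n)).
  rewrite ler_wpM2r//; first by case/andP: (step_function_itv n y01).
  rewrite natrM -mulrA ler_peMr// natrX -exprMn exprn_ege1//.
  by rewrite mulrC -ler_pdivrMr// mul1r.
- exact: cvg_cst.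
- by rewrite -cvg_shiftS; exact: cvg_harmonic.
Unshelve. all: by end_near. Qed.

End StepPolynomials.

Section MomentDeterminacy.
Variable R : realType.
Implicit Types (mu : {measure set R -> \bar R}) (m : nat -> R).

(** The value depends on the measure only through [m], which is what makes two measures with equal
    moments comparable. *)
Lemma has_moments_poly mu m (p : {poly R}) : has_moments mu m ->
  mu.-integrable setT (fun x => (p.[x])%:E) /\
  (\int[mu]_x (p.[x])%:E = (\sum_(i < size p) p`_i * m i)%:E)%E.
Proof.
move=> hm.
have iZ (i : 'I_(size p)) : mu.-integrable setT (fun x => (p`_i)%:E * (x ^+ i)%:E)%E.
  by apply: integrableZl => //; case: (hm i).
have e : (fun x : R => (p.[x])%:E) =
    (fun x => \sum_(i < size p) (p`_i)%:E * (x ^+ i)%:E)%E.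
  by apply/funext => x; rewrite horner_coef -sumEFin.
split.
  by rewrite e; apply: (integrable_sum measurableT) => i _; exact: iZ.
rewrite e integral_sum// -sumEFin; apply: eq_bigr => i _.
by rewrite integralZl//; case: (hm i) => // _ ->.
Qed.

(* Markov: L^2n mu(|x| > L) <= m_2n <= M^2n rho(R) for all n. *)
Lemma moments_support mu rho m (M L : R) : 0 <= M < L ->
  has_moments mu m -> has_moments rho m -> rho (~` `[- M, M]) = 0%E ->
  mu (~` `[- L, L]) = 0%E.
Proof.
move=> /andP[M0 ML] hmu hrho rhoM.
have L0 : 0 < L by exact: le_lt_trans ML.
set B := ~` _.
have mB : measurable B by exact: measurableC.
have mpow k (D : set R) : measurable_fun D (fun x : R => (x ^+ k)%:E).
  by apply/measurable_EFinP; apply: measurable_funTS; exact: exprn_measurable.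
have even_ge0 n (x : R) : 0 <= x ^+ n.*2 by rewrite -mul2n exprM exprn_ge0// sqr_ge0.
have rho1 : (rho setT = (m 0%N)%:E)%E by exact: has_moments_mass.
have m0 : 0 <= m 0%N by rewrite -lee_fin -rho1.
have le_m n : m n.*2 <= M ^+ n.*2 * m 0%N.
  have [_ e] := hrho n.*2.
  rewrite -lee_fin -e EFinM -rho1 -integral_cst//.
  apply: ae_ge0_le_integral => //.
  - by move=> x _; rewrite lee_fin.
  - by move=> x _; rewrite lee_fin exprn_ge0.
  exists (~` `[- M, M]); split => //; first exact: measurableC.
  move=> x /=; apply: contra_not; rewrite in_itv/= -ler_norml => xM _.
  rewrite lee_fin -[leLHS]ger0_norm// normrX lerXn2r ?nnegrE//.
have mu_le n : (mu B <= ((M / L) ^+ n.*2 * m 0%N)%:E)%E.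
  have Ln : 0 < L ^+ n.*2 by rewrite exprn_gt0.
  have : ((L ^+ n.*2)%:E * mu B <= (M ^+ n.*2 * m 0%N)%:E)%E.
    have [_ e] := hmu n.*2.
    apply: (@le_trans _ _ (m n.*2)%:E); last by rewrite lee_fin.
    rewrite -e -integral_cst//.
    apply: (@le_trans _ _ (\int[mu]_(x in B) (x ^+ n.*2)%:E)%E).
      apply: ge0_le_integral => //.
      - by move=> x _; rewrite lee_fin ltW.
      move=> x /= /negP; rewrite in_itv/= -ler_norml -ltNge => Lx.
      by rewrite lee_fin -[leRHS]ger0_norm// normrX lerXn2r ?nnegrE// ltW.
    by apply: ge0_subset_integral => // x _; rewrite lee_fin.
  rewrite -lee_pdivlMl//; move/le_trans; apply.
  by rewrite -EFinM lee_fin expr_div_n; move: (L ^+ _) Ln => z z0;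
    rewrite [leRHS]mulrAC mulrC.
apply/eqP; rewrite eq_le measure_ge0 andbT.
have lim : (fun n => ((M / L) ^+ n.*2 * m 0%N)%:E) @ \oo --> (0%:E : \bar R).
  apply: cvg_EFin; first by near=> n.
  rewrite -[X in _ --> X](mul0r (m 0%N)); apply: cvgMl.
  rewrite (_ : (fun n => _) = (fun n => ((M / L) ^+ 2) ^+ n)).
    apply: cvg_expr; rewrite ger0_norm ?sqr_ge0// expr_lt1// ?divr_ge0// ?ltW//.
    by rewrite ltr_pdivrMr// mul1r.
  by apply/funext => n; rewrite -exprM mul2n.
have -> : 0%E = limn (fun n => ((M / L) ^+ n.*2 * m 0%N)%:E) by exact/esym/cvg_lim.
apply: lime_ge; first by apply/cvg_ex; exists 0%:E.
by near=> n; exact: mu_le.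
Unshelve. all: by end_near. Qed.

(* The affine map 1/2 + (x - c) / 4L sends [-L, L] into [0, 1] and c to 1/2. *)
Lemma cvg_step_integral mu m (L c : R) : 0 < L -> `|c| <= L ->
  has_moments mu m -> mu (~` `[- L, L]) = 0%E ->
  (fun n => \int[mu]_x (step_function n (2^-1 + (x - c) / (4 * L)))%:E)%E @ \oo -->
  mu `]-oo, c[%classic.
Proof.
move=> L0 cL hmu muL; pose D : set R := `[- L, L]%classic.
have L4 : 0 < 4 * L by rewrite mulr_gt0.
have mD : measurable D by exact: measurable_itv.
pose y (x : R) := 2^-1 + (x - c) / (4 * L).
pose p n : {poly R} := (1 - ((2^-1 - c / (4 * L))%:P + (4 * L)^-1 *: 'X) ^+ n) ^+ (n * 2 ^ n).
have pE n x : step_function n (y x) = (p n).[x].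
  by rewrite /step_function /p !hornerE /y; congr ((1 - _ ^+ _) ^+ _); ring.
have yD x : D x -> 0 <= y x <= 1.
  rewrite /D /= in_itv/= -ler_norml => xL.
  have : `|(x - c) / (4 * L)| <= 2^-1.
    rewrite normrM normfV (ger0_norm (ltW L4)) ler_pdivrMr// (le_trans (ler_normB _ _))//.
    by apply: (le_trans (lerD xL cL)); lra.
  by rewrite ler_norml /y => /andP[h1 h2]; apply/andP; split; lra.
have yc x : (y x < 2^-1) = (x < c).
  by rewrite /y gtrDl pmulr_llt0 ?invr_gt0// subr_lt0.
have cut (A : set R) : measurable A -> mu A = mu (D `&` A).
  move=> mA; rewrite -[in LHS](setIT A) -(setUv D) setIUr measureU//; last 3 first.
  - exact: measurableI.
  - by apply: measurableI => //; exact: measurableC.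
  - by rewrite setIACA setICr setI0.
  rewrite (setIC A D) [X in (_ + X)%E](_ : _ = 0%E) ?adde0//.
  apply/eqP; rewrite eq_le measure_ge0 andbT -muL le_measure ?inE//.
  - by apply: measurableI => //; exact: measurableC.
  - exact: measurableC.
have intD n : (\int[mu]_x (step_function n (y x))%:E =
    \int[mu]_(x in D) (step_function n (y x))%:E)%E.
  have [ip _] := has_moments_poly (p n) hmu.
  rewrite (negligible_integral (measurableC mD) measurableT _ muL)//.
    by rewrite setDE setTI setCK.
  by apply: eq_integrable ip => // x _; rewrite pE.
rewrite -[X in X @ _ --> _]/(fun n => \int[mu]_x (step_function n (y x))%:E)%E.
under eq_fun do rewrite intD.
have [//|//||||] := @dominated_convergence _ _ R mu D mD
  (fun n x => (step_function n (y x))%:E) (fun x => (\1_`]-oo, c[ x)%:E) (cst 1%E).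
- move=> n; have [/measurable_int mp _] := has_moments_poly (p n) hmu.
  apply: measurable_funTS; rewrite (_ : (fun x => _) = (fun x => ((p n).[x])%:E))//.
  by apply/funext => x; rewrite pE.
- by apply: measurable_funTS; apply/measurable_EFinP; exact: measurable_indic.
- apply: aeW => x Dx; apply: cvg_EFin; first by near=> n.
  have := cvg_step_function (yD x Dx); rewrite yc indicE.
  by rewrite (_ : (x \in _) = (x < c))// mem_setE in_itv.
- have [i0 _] := hmu 0%N; apply: (@integrableS _ _ _ mu setT) => //.
- apply: aeW => x n Dx; rewrite /= lee_fin.
  by have /andP[s0 s1] := step_function_itv n (yD x Dx); rewrite ger0_norm.
move=> _ _; rewrite integral_indic// (_ : mu _ = mu `]-oo, c[%classic)//.
by rewrite setIC; exact/esym/cut.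
Unshelve. all: by end_near. Qed.

(** The step polynomials have equal integrals under both measures, so the limits, the masses of
    ]-oo, c[, agree. These half lines are stable under intersection, generate the Borel sets and
    exhaust the line. *)
Lemma moment_determinacy mu rho m (M : R) : 0 <= M ->
  has_moments mu m -> has_moments rho m -> rho (~` `[- M, M]) = 0%E ->
  forall A, measurable A -> mu A = rho A.
Proof.
move=> M0 hmu hrho rhoM.
have half_lines c : mu `]-oo, c[%classic = rho `]-oo, c[%classic.
  (* Larger than [M], as the Markov argument requires, and at least |c|, as the affine map to [0, 1]
     requires. *)
  pose L := M + 1 + `|c|.
  have ML : M < L by rewrite /L -addrA ltrDl ltr_wpDr.
  have L0 : 0 < L by exact: le_lt_trans ML.
  have cL : `|c| <= L by rewrite lerDr addr_ge0.
  have muL : mu (~` `[- L, L]) = 0%E.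
    by apply: (@moments_support mu rho m M L) => //; rewrite M0.
  have rhoL : rho (~` `[- L, L]) = 0%E.
    by apply: (@moments_support rho rho m M L) => //; rewrite M0.
  have := cvg_step_integral L0 cL hmu muL.
  have := cvg_step_integral L0 cL hrho rhoL.
  rewrite (_ : (fun n => \int[rho]_x _)%E =
    (fun n => \int[mu]_x (step_function n (2^-1 + (x - c) / (4 * L)))%:E)%E).
    by move=> h1 h2; apply: (cvg_unique _ h2 h1).
  apply/funext => n.
  pose p : {poly R} := (1 - ((2^-1 - c / (4 * L))%:P + (4 * L)^-1 *: 'X) ^+ n) ^+ (n * 2 ^ n).
  have pE x : step_function n (2^-1 + (x - c) / (4 * L)) = p.[x].
    by rewrite /step_function /p !hornerE; congr ((1 - _ ^+ _) ^+ _); ring.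
  under eq_integral do rewrite pE.
  under [RHS]eq_integral do rewrite pE.
  by rewrite (has_moments_poly p hmu).2 (has_moments_poly p hrho).2.
apply: (@measure_unique _ R R (@RGenInftyO.G R) (fun n => `]-oo, n%:R[%classic)).
- exact: RGenInftyO.measurableE.
- move=> A B [a ->] [b ->]; exists (Num.min a b).
  apply/seteqP; split => x /=; rewrite !in_itv/= lt_min.
    by move=> [-> ->].
  by move=> /andP[].
- by move=> n; exists n%:R.
- apply/seteqP; split => // x _; exists (Num.truncn `|x|).+1 => //=.
  rewrite in_itv/=; apply: (le_lt_trans (ler_norm x)).
  by rewrite truncnS_gt.
- by move=> A [a ->]; exact: half_lines.
- move=> k; apply: (@le_lt_trans _ _ (mu setT)).
    by apply: le_measure; rewrite ?inE.
  by rewrite (has_moments_mass hmu) ltry.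
Qed.

End MomentDeterminacy.

(** * The limit law *)

(** The total mass 1 in the definition plays the part of moment 0. For k > 0, uniqueness of limits
    identifies the moments, and integrability guarantees that [fine] loses nothing. *)
Lemma limit_distribution_moments (R : realType) (tau : nat -> nat -> R[i])
    (mu : {measure set R -> \bar R}) (m : nat -> R) : m 0%N = 1 ->
  (forall k, (0 < k)%N -> (tau k : nat -> R[i]^o) @ \oo --> ((m k)%:C%C : R[i]^o)) ->
  is_limit_distribution tau mu <-> has_moments mu m.
Proof.
move=> m0 cvg_tau; split=> [[mu1 Hmu] [|k]|hm].
- have int1 : (\int[mu]_x (cst 1%E x) = 1)%E by rewrite integral_cst// mul1e.
  rewrite m0; split; last exact: int1.
  apply/integrableP; split.
    by apply/measurable_EFinP; exact: exprn_measurable.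
  by under eq_integral do rewrite /= normr1; rewrite int1 ltry.
- have [int_k cvg_k] := Hmu k.+1 isT; split => //.
  rewrite -[LHS]fineK; last exact: integrable_fin_num.
  have := cvg_unique (@norm_hausdorff _ R[i]^o) cvg_k (cvg_tau k.+1 isT).
  by move=> /(_ _)/(congr1 (@complex.Re R))/= ->.
- split; first by rewrite (has_moments_mass hm) m0.
  move=> k k0; have [int_k ->] := hm k; split=> //=; exact: cvg_tau.
Qed.

Theorem corollary9p1 (R : realType)
    (disp : nat -> measure_display)
    (Omega : forall n : nat, measurableType (disp n))
    (P : forall n : nat, probability (Omega n) R)
    (N : forall n : nat, 'I_2 -> {set 'I_n})
    (d : 'I_2 -> R)
    (v : 'M[R]_2)
    (Y : forall n : nat, Omega n -> 'M[R[i]]_n)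
    (HN : forall n : nat, (1 < n)%N -> is_interval_partition (N n))
    (Hd : forall q : 'I_2, (fun n : nat => #|N n q|%:R / n%:R : R) @ \oo --> d q)
    (v_ge0 : forall a b : 'I_2, 0 <= v a b)
    (v_sym : forall a b : 'I_2, v a b = v b a)
    (v_12 : v 0 1 = 1)
    (HY : forall n : nat, (1 < n)%N -> is_block_gaussian (P n) (N n) v (Y n))
    (d1_gt0 : 0 < d 0) :
  let B n w := off_diagonal_block (N n) (Y n w) in
  let tau k n :=
    partial_trace (P n) (N n 0) (fun w => (B n w *m adjoint (B n w)) ^+ k) in
  (forall k : nat, (0 < k)%N ->
     (tau k : nat -> R[i]^o) @ \oo -->
       ((d 0 ^+ k * narayana_poly k (d 1 / d 0))%:C%C : R[i]^o)) /\
  is_limit_distribution tau (dilation (d 0) (marchenko_pastur (d 1 / d 0))) /\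
  (forall mu : {measure set R -> \bar R}, is_limit_distribution tau mu ->
     forall A : set R, measurable A ->
       mu A = dilation (d 0) (marchenko_pastur (d 1 / d 0)) A).
Proof.
move=> B tau.
pose m k := d 0 ^+ k * narayana0 (d 1 / d 0) k.
have cvg_tau k : (tau k : nat -> R[i]^o) @ \oo --> ((m k)%:C%C : R[i]^o).
  exact: cvg_block_trace HN Hd v_ge0 v_12 HY d1_gt0 k.
have m0 : m 0%N = 1 by rewrite /m expr0 mul1r.
have d2_ge0 : 0 <= d 1.
  rewrite -(cvg_lim _ (Hd 1))//; apply: limr_ge; first by apply/cvg_ex; exists (d 1).
  by near=> n; rewrite divr_ge0.
have t_ge0 : 0 <= d 1 / d 0 by rewrite divr_ge0// ltW.
have moments := dilation_moments (d 0) (marchenko_pastur_moments t_ge0).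
have limit_iff mu := @limit_distribution_moments R tau mu m m0 (fun k _ => cvg_tau k).
(* For positive k the values of [narayana0] and [narayana_poly] are convertible; they differ only at
   0. *)
split; first by case=> [|k] k0; [discriminate k0|exact: (cvg_tau k.+1)].
split; first exact/limit_iff.
move=> mu /limit_iff hmu.
apply: (moment_determinacy _ hmu moments (dilation_mp_support _ d1_gt0)).
by rewrite mulr_ge0 ?sqr_ge0// ltW.
Unshelve. all: by end_near. Qed.
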